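(* For each $K\in\{2,3,\dots\}$, $a^G_K M_{0,K}$ is a precise merging function, where $$a^G_K:=\frac{1}{c_K}\exp\left(-(K-1)(1-Kc_K)\right)$$ and $c_K$ is the unique solution to the equation $$\ln\left(\frac1c-(K-1)\right)=K-K^2c$$ over $c\in(0,1/K)$. Moreover, $a^G_K\le e$ and $a^G_K\to e$ as $K\to\infty$.
   Context: $M_{0,K}(p_1,\dots,p_K):=\left(\prod_{k=1}^Kp_k\right)^{1/K}$ is the geometric mean on $[0,1]^K$. Fix an atomless probability space and let $\mathcal{U}$ be the set of all random variables on it uniformly distributed on $[0,1]$. A merging function is a Borel function $F:[0,1]^K\to[0,\infty)$, increasing (in the weak sense) in each argument, such that for each $\epsilon\in(0,1)$, $\sup\{\mathbb{P}(F(U_1,\dots,U_K)\le\epsilon)\mid U_1,\dots,U_K\in\mathcal{U}\}\le\epsilon$. A merging function is precise if this supremum equals $\epsilon$ for each $\epsilon\in(0,1)$.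
   Formalization: For K = 2 the equation has no solution in the open interval (0,1/2), so c_2 is taken to be 1/2, the unique solution in (0,1/2]; for K ≥ 3, c_K is the unique solution in (0,1/K) as stated. *)

(* Defs.v *)
From HB Require Import structures.
From mathcomp Require Import all_boot all_order all_algebra.
From mathcomp Require Import all_classical all_reals all_analysis.

Set Implicit Arguments.
Unset Strict Implicit.
Unset Printing Implicit Defensive.

Import Order.TTheory GRing.Theory Num.Theory.
Import numFieldTopology.Exports numFieldNormedType.Exports.

Local Open Scope classical_set_scope.
Local Open Scope ring_scope.

Definition atomless (d : measure_display) (T : measurableType d)
    (R : realType) (P : probability T R) : Prop :=
  forall A : set T, measurable A -> (0 < P A)%E ->
  exists B : set T,
    [/\ measurable B, B `<=` A, (0 < P B)%E & (P B < P A)%E].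

(* The values are required to lie in [0, 1] everywhere, and not only almost
   surely, so that functions on the unit cube can be evaluated at the variables;
   any a.s. version can be modified on a null set to satisfy this. *)
Definition uniform01 (d : measure_display) (T : measurableType d)
    (R : realType) (P : probability T R) (U : {RV P >-> R}) : Prop :=
  (forall w, U w \in `[0, 1]) /\
  (forall A : set R, measurable A ->
     distribution P U A = uniform_prob (@ltr01 R) A).

Definition cube (R : realType) (K : nat) : set (K.-tuple R) :=
  [set p | forall i, tnth p i \in `[0, 1]].

(* sup of P(F(U_1, ..., U_K) <= e) over all joint distributions of
   U_1, ..., U_K uniform on [0, 1]. *)
Definition sup_prob_le (d : measure_display) (T : measurableType d)
    (R : realType) (P : probability T R) (K : nat) (F : K.-tuple R -> R)
    (e : R) : \bar R :=
  ereal_sup [set P [set w | F [tuple U i w | i < K] <= e] |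
    U in [set U : 'I_K -> {RV P >-> R} | forall i, uniform01 (U i)]].

(* A function on [0, 1]^K is represented by a function on R^K of which only the
   values on the cube are used. *)
Record merging_function (d : measure_display) (T : measurableType d)
    (R : realType) (P : probability T R) (K : nat)
    (F : K.-tuple R -> R) : Prop := MergingFunction {
  merging_borel : measurable_fun (@cube R K) F ;
  merging_ge0 : forall p, cube p -> 0 <= F p ;
  merging_increasing : forall (i : 'I_K) (p q : K.-tuple R),
    cube p -> cube q -> (forall j, j != i -> tnth p j = tnth q j) ->
    tnth p i <= tnth q i -> F p <= F q ;
  merging_valid : forall e : R, 0 < e < 1 -> (sup_prob_le P F e <= e%:E)%E
}.

Definition precise_merging_function (d : measure_display)
    (T : measurableType d) (R : realType) (P : probability T R) (K : nat)
    (F : K.-tuple R -> R) : Prop :=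
  merging_function P F /\
  forall e : R, 0 < e < 1 -> sup_prob_le P F e = e%:E.

Definition geometric_mean (R : realType) (K : nat) (p : K.-tuple R) : R :=
  (\prod_(k < K) tnth p k) `^ (K%:R^-1).

(* On ]0, 1/K[ the argument of ln is > 1, so the junk values of ln do not
   matter.  The point 1/K is always a solution; for K = 2 it is the only
   solution in ]0, 1/K], and ]0, 1/K[ contains none. *)
Definition cK_equation (R : realType) (K : nat) (c : R) : Prop :=
  ln (c^-1 - (K%:R - 1)) = K%:R - K%:R ^+ 2 * c.

Definition aG (R : realType) (K : nat) (c : R) : R :=
  c^-1 * expR (- ((K%:R - 1) * (1 - K%:R * c))).

(* Main.v *)
Require Import Defs.
From HB Require Import structures.
From mathcomp Require Import all_boot all_order all_algebra.
From mathcomp Require Import all_classical all_reals all_analysis.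
From mathcomp Require Import measurable_realfun zify ring lra.
Import Order.TTheory GRing.Theory Num.Theory.
Import numFieldTopology.Exports numFieldNormedType.Exports.
Local Open Scope classical_set_scope.
Local Open Scope ring_scope.

Set Implicit Arguments.
Unset Strict Implicit.
Unset Printing Implicit Defensive.

(** Write m = K - 1, A = 1 - m c and D = K - K^2 c. The equation for c says that
    exp D = A / c, and then a = aG K c satisfies a^K c A^m = 1. So, for points u
    of the cube, a M(u) <= e means that the product of the u_k is at most
    e^K c A^m, and everything below is about that product.

    The constant. The difference of the two sides of the equation decreases on
    ]0, 1/(K m)] and then increases to its zero 1/K. Hence for K > 2 there is
    exactly one root below 1/K, and it lies below 1/(K m). In terms of that root
    a = exp (1 - K c) / A, and K m c <= 1 gives both a <= exp 1 (through
    exp (K c) >= 1 + K c) and a >= exp (1 - 1/m), whence the limit.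

    Validity. Let q = exp (- D / N). If the product of the u_k is at most
    e^K c A^m = (e A)^K q^N, then at least N pairs (i, k) with k < N satisfy
    u_i <= e A q^k ([prod_le_count]). By Markov's inequality N times the
    probability of the event is at most K e A (1 + q + ... + q^(N-1)), and for
    N -> oo the bound obtained tends to e K (A - c) / D = e. This discretizes
    the dual bound given by the integral of a function that is affine in - ln u
    between the levels u = e c and u = e A. For K = 2 these two levels coincide,
    D = 0, and the union bound with the single level e / 2 is enough.

    Precision. It is enough to couple K uniform variables on [0, 1] so that their
    product never exceeds rho^2 c A^m, with rho > 1 arbitrary: scaling by
    e' = e / rho on an event of probability e' then gives probability at least e'
    at level e. With probability c for each s, coordinate s is uniform on [0, c]
    and every other one equals 1 - m times it; as c <= 1/(K m), the product is
    largest at the end of the range ([tail_prod_le]). The remaining mass of each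
    coordinate is uniform on [c, A], where - ln u has an exponential law truncated
    to an interval of length D, and the equation for c says that its mean lies at
    distance D / K from the left end. What is needed is a coupling of K copies of
    this law whose sum is constant.

    Such couplings come from a discrete statement ([decreasing_mix]): for K > 2
    and N large, a decreasing sequence of masses on {0, ..., N} with mean at least
    N / K can be spread over K-tuples of sum at least N - 2 K, as total occupancy
    of the coordinates. Take weights of largest total mass whose remainder is still
    decreasing with mean at least N / K; they exist by compactness. If the
    remainder were not zero, it would drop at some b >= 2 N / K and, unless its
    mean is strictly too large, also at some a <= 2 N / K. For such a and b there
    is a block of tuples whose occupancy has no drop outside a and b
    ([block_exists]), and a small multiple of it could still be removed. The
    bounded loss 2 K in the sum disappears as the grid is refined.

    On an atomless space a uniform variable exists (Sierpinski's theorem and a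
    dyadic chain of events), and cutting its range into intervals realizes any
    finite mixture of affine pieces ([piecewise_uniform]). *)

(** * Blocks of tuples with nearly constant sum *)

Section Blocks.
Local Open Scope nat_scope.

Definition occupancy (M K : nat) (tau : nat -> nat -> nat) (k : nat) : nat :=
  \sum_(y < M) \sum_(i < K) (tau y i == k).

(** A small multiple of such a family of M tuples can be subtracted from a
    decreasing sequence of mean at least N / K that strictly drops at a and at b,
    and the difference is again decreasing with mean at least N / K. The slack 2 * K
    absorbs the rounding of interval ends to integers. *)
Definition block (K N a b M : nat) (tau : nat -> nat -> nat) : Prop :=
  [/\ 0 < M,
      forall y i, y < M -> i < K -> tau y i <= N,
      forall y, y < M -> N <= \sum_(i < K) tau y i + 2 * K,
      \sum_(y < M) \sum_(i < K) tau y i <= M * N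
    & forall k, k != a -> k != b -> occupancy M K tau k <= occupancy M K tau k.+1].

Lemma sum_half_double (phi : nat -> nat) h :
  \sum_(z < h.*2) phi z./2 = 2 * \sum_(z < h) phi z.
Proof.
elim: h => [|h IH]; first by rewrite !big_ord0.
rewrite doubleS !big_ord_recr /= IH.
have -> : uphalf h.*2 = h by lia.
have -> : h.*2./2 = h by lia.
by rewrite mulnDr -addnA addnn [2 * phi h]mul2n.
Qed.

Lemma sum_bound (phi : nat -> nat) n n' :
  n = n' -> \sum_(z < n) phi z = \sum_(z < n') phi z.
Proof. by move=> ->. Qed.

Lemma sum_two (phi : nat -> nat) : \sum_(z < 2) phi z = phi 0 + phi 1.
Proof. by rewrite !big_ord_recr big_ord0. Qed.

Lemma sum_addn (phi : nat -> nat) h n :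
  \sum_(z < h + n) phi z = \sum_(z < h) phi z + \sum_(z < n) phi (h + z).
Proof. by rewrite big_split_ord. Qed.

Lemma sum_rev (phi : nat -> nat) n :
  \sum_(z < n.+1) phi (n - z) = \sum_(z < n.+1) phi z.
Proof.
rewrite [RHS](reindex_inj rev_ord_inj) /=.
by apply: eq_bigr => z _; rewrite subSS.
Qed.

(** For z = n - y the three numbers z / 2, its shift to the upper half of
    {0, ..., n}, and y have nearly constant sum; the first two together run twice
    through {0, ..., n}. *)
Lemma sum_triple (phi : nat -> nat) n :
  \sum_(z < n.+1) (phi z./2 + phi (uphalf n + (z + ~~ odd n)./2)) =
  2 * \sum_(z < n.+1) phi z.
Proof.
rewrite big_split /=.
case: (boolP (odd n)) => on /=.
  have [h nE] : exists h, n.+1 = h + h by exists (uphalf n); lia.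
  have -> : uphalf n = h by lia.
  have -> : n.+1 = h.*2 by lia.
  under [X in _ + X]eq_bigr do rewrite addn0.
  rewrite (sum_half_double phi) (sum_half_double (fun z => phi (h + z))).
  by rewrite -[h.*2]addnn sum_addn mulnDr.
have [h nE] : exists h, n = h.*2 by exists (n./2); lia.
rewrite nE.
have -> : uphalf h.*2 = h by lia.
rewrite big_ord_recr [X in _ + X]big_ord_recl /= !addn0 (sum_half_double phi).
rewrite [X in _ + (_ + X)](eq_bigr (fun i : 'I_h.*2 => phi (h + i./2.+1))); last first.
  by move=> i _; congr (phi (h + _)); rewrite /bump /=; lia.
rewrite (sum_half_double (fun z => phi (h + z.+1))).
have -> : h.*2.+1 = h + h.+1 by lia.
rewrite sum_addn big_ord_recl /= addn0.
have -> : h.*2./2 = h by lia.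
rewrite (_ : \sum_(i < h) phi (h + bump 0 i) = \sum_(i < h) phi (h + i.+1)) //.
lia.
Qed.

Lemma sum_eq_shift q n k : \sum_(y < n) (q + y == k) = (q <= k < q + n).
Proof.
elim: n => [|n IH]; first by rewrite big_ord0; lia.
by rewrite big_ord_recr /= IH; lia.
Qed.

(** K coordinates on {0, ..., n} with nearly constant sum. The pair y, n - y
    handles two coordinates at a time; for odd K, the three coordinates left
    over are those of [sum_triple]. *)
Definition mix_coord (K n y i : nat) : nat :=
  if odd K && (i < 2) then
    (if i == 0 then (n - y)./2 else uphalf n + (n - y + ~~ odd n)./2)
  else if odd i then n - y else y.

Lemma sum_alternate (x y : nat) p (f : nat -> nat) :
  (forall i, i < p.*2 -> f i = if odd i then x else y) ->
  \sum_(i < p.*2) f i = p * (x + y).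
Proof.
elim: p => [|p IH] H; first by rewrite big_ord0.
rewrite doubleS !big_ord_recr /= IH; last by move=> i Hi; apply: H; lia.
rewrite !H; [|lia..].
by rewrite /= odd_double /=; lia.
Qed.

Lemma mix_sum K n y : 2 < K -> y <= n ->
  K * n <= (\sum_(i < K) mix_coord K n y i).*2 + 1.
Proof.
move=> K2 yn.
case: (boolP (odd K)) => oK.
  have [p KE] : exists p, K = 2 + (p.*2).+1 by exists (K./2.-1); lia.
  have alt : \sum_(i < (p.*2).+1) mix_coord K n y (2 + i) = p * (n - y + y) + y.
    rewrite big_ord_recr (@sum_alternate (n - y) y p (fun i => mix_coord K n y (2 + i))) /=.
      by rewrite /mix_coord andbF /= negbK odd_double.
    by move=> i _; rewrite /mix_coord andbF /= negbK.
  rewrite (sum_bound _ KE) sum_addn alt !big_ord_recr big_ord0 /= /mix_coord oK /=.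
  have -> : K * n = (p * n).*2 + 3 * n by rewrite KE; lia.
  rewrite subnK //; move: (p * n) => pn.
  by case: (boolP (odd n)) => /=; lia.
have [p KE] : exists p, K = p.*2 by exists (K./2); lia.
rewrite (sum_bound _ KE) (@sum_alternate (n - y) y).
  by rewrite subnK // KE; lia.
by move=> i _; rewrite /mix_coord (negbTE oK).
Qed.

Lemma mix_occ K n (phi : nat -> nat) : 2 < K ->
  \sum_(y < n.+1) \sum_(i < K) phi (mix_coord K n y i) =
  K * \sum_(y < n.+1) phi y.
Proof.
move=> K2; rewrite exchange_big /=.
have alt i : \sum_(y < n.+1) phi (if odd i then n - y else y) = \sum_(y < n.+1) phi y.
  by case: (odd i) => //; exact: (sum_rev phi).
case: (boolP (odd K)) => oK; last first.
  under eq_bigr => i _.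
    under eq_bigr => y _ do rewrite /mix_coord (negbTE oK) /=.
    rewrite alt; over.
  by rewrite sum_nat_const card_ord.
have KE : K = 2 + (K - 2) by lia.
set S := \sum_(y < n.+1) phi y.
rewrite [LHS](sum_bound (fun i => \sum_(y < n.+1) phi (mix_coord K n y i)) KE).
rewrite [LHS](sum_addn (fun i => \sum_(y < n.+1) phi (mix_coord K n y i))).
rewrite (_ : \sum_(i < K - 2) _ = (K - 2) * S); last first.
  rewrite -[X in X * _]card_ord -sum_nat_const; apply: eq_bigr => i _.
  by rewrite /S -(alt i); apply: eq_bigr => y _; rewrite /mix_coord andbF /= negbK.
rewrite [X in X + _](sum_two (fun i => \sum_(y < n.+1) phi (mix_coord K n y i))).
rewrite /mix_coord oK /=.
have /= -> := sum_rev (fun z => phi z./2) n.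
have /= -> := sum_rev (fun z => phi (uphalf n + (z + ~~ odd n)./2)) n.
rewrite -big_split /= sum_triple -/S.
nia.
Qed.

Lemma mix_coord_le K n y i : y <= n -> mix_coord K n y i <= n.
Proof. by rewrite /mix_coord => yn; do !case: ifP => _; lia. Qed.

Lemma sum_ord_id n : (\sum_(y < n.+1) (y : nat)).*2 = n * n.+1.
Proof.
elim: n => [|n IH]; first by rewrite big_ord_recr big_ord0.
by rewrite big_ord_recr /= doubleD IH; lia.
Qed.

(** Here a lies between N / K and 2 N / K, and all coordinates can be spread
    uniformly over [q, a], with q + a close to 2 N / K. *)
Lemma block_all_a K N a b : 2 < K -> K * a <= 2 * N -> N <= K * a ->  a <= N ->
  exists M tau, block K N a b M tau.
Proof.
move=> K2 aN Na aN'.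
pose q := (2 * N) %/ K - a.
have K0 : 0 < K by lia.
have h1 : K * (q + a) <= 2 * N.
  have : a <= (2 * N) %/ K by rewrite leq_divRL //; lia.
  have := leq_trunc_div (2 * N) K.
  by rewrite /q; nia.
have h2 : 2 * N < K * (q + a).+1.
  have : a <= (2 * N) %/ K by rewrite leq_divRL //; lia.
  have := ltn_ceil (2 * N) K0.
  by rewrite /q; nia.
have qa : q <= a by nia.
pose n := a - q.
exists n.+1, (fun y i => q + mix_coord K n y i).
have S y : \sum_(i < K) (q + mix_coord K n y i) = K * q + \sum_(i < K) mix_coord K n y i.
  by rewrite big_split sum_nat_const card_ord /=.
split => //.
- by move=> y i yn _; have := @mix_coord_le K n y i; rewrite /n in yn *; lia.
- move=> y yn; rewrite S.
  have := @mix_sum K n y K2 yn.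
  move: h2; have -> : q + a = 2 * q + n by rewrite /n; lia.
  by lia.
- rewrite (mix_occ n (fun z => q + z) K2) big_split sum_nat_const card_ord /=.
  have E := sum_ord_id n; have := congr1 (muln K) E.
  have h3 : K * (2 * q + n) <= 2 * N by have -> : 2 * q + n = q + a by rewrite /n; lia.
  have := leq_mul (leqnn n.+1) h3.
  move: (\sum_(y < n.+1) (y : nat)) => s.
  clear; nia.
- move=> k ka kb; rewrite /occupancy.
  rewrite (mix_occ n (fun z => q + z == k) K2) (mix_occ n (fun z => q + z == k.+1) K2).
  by rewrite !sum_eq_shift leq_mul2l; apply/orP; right; rewrite /n; lia.
Qed.

(** Start from the tuple with j entries b and K - j entries a, j being least with
    sum at least N. The excess R is then smaller than b - a, and letting two of
    the entries b run through [b - R, b] in opposite directions removes it. *)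
Lemma block_pair K N a b : K * a < N -> 2 * N <= K * b -> b <= N -> b + (K.-1) * a < N -> 2 < K ->
  exists M tau, block K N a b M tau.
Proof.
move=> aN bN bN' H K2.
pose S j := j * b + (K - j) * a.
have ab : a < b by nia.
have [j [j2 jK SN SN']] : exists j, [/\ 2 <= j, j <= K, N <= S j & S j < N + (b - a)].
  have ex : exists j, N <= S j by exists K; rewrite /S; nia.
  case: (ex_minnP ex) => j Nj jmin.
  (* j <= 1 is excluded because b + (K - 1) a < N. *)
  have j1 : 1 < j.
    move: Nj; rewrite /S; case: j jmin => [|[|j]] //=; nia.
  have jK : j <= K by apply: jmin; rewrite /S; nia.
  exists j; split => //.
  have := jmin j.-1; rewrite /S => H'.
  rewrite ltnNge; apply/negP => Hc.
  have : j <= j.-1 by apply: H'; nia.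
  lia.
pose R := S j - N.
pose tau (t i : nat) := if i == 0 then b - t else if i == 1 then b - R + t else if i < j then b else a.
have Rb : R < b - a by rewrite /R; lia.
have split_sum (f : nat -> nat) : \sum_(i < K) f i =
  f 0 + f 1 + \sum_(i < j - 2) f (2 + i) + \sum_(i < K - j) f (j + i).
  have -> : \sum_(i < K) f i = \sum_(i < j + (K - j)) f i by apply: sum_bound; rewrite subnKC.
  rewrite sum_addn; congr (_ + _).
  have -> : \sum_(i < j) f i = \sum_(i < 2 + (j - 2)) f i by apply: sum_bound; rewrite subnKC.
  by rewrite sum_addn !big_ord_recr big_ord0.
have tau_sum (phi : nat -> nat) t : \sum_(i < K) phi (tau t i) =
   phi (b - t) + phi (b - R + t) + (j - 2) * phi b + (K - j) * phi a.
  rewrite (split_sum (fun i => phi (tau t i))) /tau /=; congr (_ + _ + _).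
    rewrite -[X in _ = X * _]card_ord -sum_nat_const; apply: eq_bigr => i _.
    by rewrite /= (_ : 2 + i < j) //; have := ltn_ord i; lia.
  rewrite -[X in _ = X * _]card_ord -sum_nat_const; apply: eq_bigr => i _.
  have -> : (j + i == 0) = false by lia.
  have -> : (j + i == 1) = false by lia.
  by have -> : (j + i < j) = false by lia.
have sumN t : t <= R -> \sum_(i < K) tau t i = N.
  move=> tR; rewrite (tau_sum id) /=.
  have : N + R = S j by rewrite /R; lia.
  rewrite /S => E.
  have -> : b - t + (b - R + t) = 2 * b - R by lia.
  have : 2 * b <= j * b by nia.
  by rewrite mulnBl; lia.
exists R.+1, tau; split => //.
- by move=> y i yR _; rewrite /tau; do !case: ifP => _; lia.
- by move=> y yR; rewrite sumN; lia.
- rewrite (eq_bigr (fun=> N)); first by rewrite sum_nat_const card_ord.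
  by move=> y _; apply: sumN; have := ltn_ord y; lia.
- move=> k ka kb; rewrite /occupancy.
  have occE k' : \sum_(y < R.+1) \sum_(i < K) (tau y i == k') =
     2 * (b - R <= k' < b - R + R.+1) + R.+1 * ((j - 2) * (b == k') + (K - j) * (a == k')).
    under eq_bigr => y _ do rewrite (tau_sum (fun z => z == k')) -addnA.
    rewrite big_split /= sum_nat_const card_ord; congr (_ + _).
    rewrite big_split /= sum_eq_shift mul2n -addnn; congr (_ + _).
    rewrite -(sum_eq_shift (b - R) R.+1 k').
    rewrite -(sum_rev (fun z => b - R + z == k')).
    apply: eq_bigr => y _.
    by congr (nat_of_bool (_ == _)); have := ltn_ord y; lia.
  rewrite !occE.
  have -> : (b == k) = false by lia.
  have -> : (a == k) = false by lia.
  rewrite !muln0 addn0.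
  apply: leq_trans (leq_addr _ _).
  by rewrite leq_mul2l /=; lia.
Qed.

Lemma sum_edivn (phi : nat -> nat -> nat) m n : 0 < m ->
  \sum_(y < m * n) phi (y %/ m) (y %% m) = \sum_(v < n) \sum_(e < m) phi v e.
Proof.
move=> m0; elim: n => [|n IH]; first by rewrite muln0 !big_ord0.
rewrite mulnS addnC (sum_addn (fun y => phi (y %/ m) (y %% m))) IH big_ord_recr /=; congr (_ + _).
apply: eq_bigr => e _.
by rewrite mulnC divnMDl // modnMDl divn_small // modn_small // addn0.
Qed.

(** With a single entry b, the other m = K - 1 entries climb together from l to
    a while b descends: each level of the m entries is held for m steps, so that
    one descent by m pays for one ascent of all of them. *)
Lemma block_one_b K N a b : K * a < N -> 2 * N <= K * b -> b <= N -> N <= b + K.-1 * a -> 2 < K ->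
  2 * K ^ 2 <= N ->
  exists M tau, block K N a b M tau.
Proof.
move=> aN bN bN' H K2 NK.
pose m := K.-1.
have m0 : 0 < m by rewrite /m; lia.
have KE : K = m.+1 by rewrite /m; lia.
pose l := (N - b) %/ m.
have l1 : m * l <= N - b by rewrite /l mulnC leq_trunc_div.
have l2 : N - b < m * l + m by have := ltn_ceil (N - b) m0; rewrite -/l; lia.
have la : l <= a.
  by rewrite -(leq_pmul2l m0); move: H; rewrite -/m; lia.
pose n := (a - l).+1.
pose tau y i := if i < m then l + y %/ m else b - y.
(* The descending entry must not pass below 0; N being large covers small a. *)
have mn : m * n <= b.+1.
  have : m * a + 2 * m <= N.
    have E1 : m * a + a < N by move: aN; rewrite KE mulSn addnC.
    have [am|am] := leqP (2 * m) a; first by lia.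
    have : m * a <= m * (2 * m) by rewrite leq_mul2l (ltnW am) orbT.
    have : 2 * (m * m + m) <= N.
      by apply: leq_trans NK; rewrite KE -mulnn; lia.
    lia.
  rewrite /n mulnS mulnBr; have : m * l <= m * a by rewrite leq_mul2l la orbT.
  lia.
exists (m * n), tau.
have tau_sum (phi : nat -> nat) y : \sum_(i < K) phi (tau y i) =
   m * phi (l + y %/ m) + phi (b - y).
  have -> : \sum_(i < K) phi (tau y i) = \sum_(i < m.+1) phi (tau y i).
    exact: (sum_bound (fun i => phi (tau y i)) KE).
  rewrite big_ord_recr /= {2}/tau ltnn; congr (_ + _).
  rewrite -[X in _ = X * _]card_ord -sum_nat_const; apply: eq_bigr => i _.
  by rewrite /tau ltn_ord.
have ymod y : y = m * (y %/ m) + y %% m by rewrite {1}(divn_eq y m) mulnC.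
have ymod2 y : y %% m < m by rewrite ltn_mod.
have yn y : y < m * n -> y %/ m < n by rewrite ltn_divLR // mulnC.
have sumE y : y < m * n -> m * (l + y %/ m) + (b - y) + y %% m = m * l + b.
  by move=> yM; have := ymod y; rewrite mulnDr; lia.
split.
- by rewrite muln_gt0 m0.
- move=> y i yM iK; rewrite /tau; case: ifP => _; last lia.
  have := yn y yM; rewrite /n; have : a <= N by apply: leq_trans (ltnW aN); rewrite leq_pmull // KE.
  lia.
- move=> y yM; rewrite (tau_sum id) /=.
  by have := sumE y yM; have := ymod2 y; lia.
- rewrite -[X in _ <= X * _]card_ord -sum_nat_const; apply: leq_sum => y _.
  rewrite (tau_sum id) /=.
  by have := sumE y (ltn_ord y); lia.
- move=> k ka kb; rewrite /occupancy.
  have occE k' : \sum_(y < m * n) \sum_(i < K) (tau y i == k') =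
     m * (m * (l <= k' < l + n)) + (b.+1 - m * n <= k' <= b).
    under eq_bigr => y _ do rewrite (tau_sum (fun z => z == k')).
    rewrite big_split /= -big_distrr /=; congr (_ * _ + _).
      rewrite (sum_edivn (fun v _ => l + v == k')) //.
      under eq_bigr => v _ do rewrite sum_nat_const card_ord.
      by rewrite -big_distrr /= sum_eq_shift.
    have [M' ME] : exists M', m * n = M'.+1 by exists (m * n).-1; rewrite prednK // muln_gt0 m0.
    rewrite ME in mn *.
    rewrite (_ : (b.+1 - M'.+1 <= k' <= b) = (b - M' <= k' < b - M' + M'.+1)); last lia.
    rewrite -sum_eq_shift -(sum_rev (fun z => b - M' + z == k')).
    apply: eq_bigr => y _.
    by congr (nat_of_bool (_ == _)); have := ltn_ord y; lia.
  rewrite !occE; apply: leq_add; last lia.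
  by rewrite !leq_mul2l; apply/orP; right; apply/orP; right; rewrite /n; lia.
Qed.

Lemma block_exists K N a b : 2 < K -> 2 * K ^ 2 <= N ->
  K * a <= 2 * N -> 2 * N <= K * b -> b <= N -> exists M tau, block K N a b M tau.
Proof.
move=> K2 NK aN bN bN'.
have [Na|Na] := leqP N (K * a).
  by apply: block_all_a => //; nia.
have [H|H] := leqP N (b + K.-1 * a).
  exact: block_one_b.
exact: block_pair.
Qed.

End Blocks.

(** * Linear programs attain their maximum *)

Lemma continuous_linear_form (R : realType) n (a : 'I_n -> R) :
  continuous (fun v : 'rV[R]_n => \sum_i a i * v ord0 i).
Proof.
apply: (@continuous_big _ _ _ _ xpredT _ _ _ (fun i (v : 'rV[R]_n) => a i * v ord0 i)).
  exact: add_continuous.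
move=> i _ v; apply: (@continuousM _ _ (fun=> a i) (fun v : 'rV[R]_n => v ord0 i)); [exact: cst_continuous | exact: coord_continuous].
Qed.

(** The feasible set is closed and contained in a cube, hence compact. *)
Lemma linear_program_max (R : realType) (T J : finType)
    (a : J -> T -> R) (b : J -> R) (M : R) (w0 : T -> R) :
  let feasible w := forall j, \sum_t a j t * w t <= b j in
  (forall w, feasible w -> forall t, - M <= w t <= M) ->
  feasible w0 ->
  exists2 w, feasible w & forall w', feasible w' -> \sum_t w' t <= \sum_t w t.
Proof.
move=> feasible bnd f0.
pose n := #|T|.
pose fn (v : 'rV[R]_n) (t : T) := v ord0 (enum_rank t).
have sumE (h : T -> R) (v : 'rV[R]_n) :
  \sum_t h t * fn v t = \sum_(i < n) h (enum_val i) * v ord0 i.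
  rewrite (reindex (@enum_val T xpredT)) /=; last first.
    by apply: onW_bij; exact: enum_val_bij.
  by apply: eq_bigr => i _; rewrite /fn enum_valK.
pose S := [set v : 'rV[R]_n | feasible (fn v)].
have Scl : closed S.
  have -> : S = \bigcap_(j in [set: J]) ((fun v : 'rV[R]_n => \sum_(i < n) a j (enum_val i) * v ord0 i) @^-1` [set x | x <= b j]).
    apply/seteqP; split => v /=.
      by move=> fv j _ /=; rewrite -(sumE (a j)); exact: fv.
    by move=> fv j; rewrite (sumE (a j)); exact: fv.
  apply: closed_bigI => j _; apply: preimage_closed; last exact: closed_le.
  by move=> v _; exact: continuous_linear_form.
have Sco : compact S.
  have co : compact [set v : 'rV[R]_n | forall i, v ord0 i \in `[- M, M]].
    apply: (@rV_compact _  _ (fun=> `[- M, M]%classic)).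
    by move=> _; apply: segment_compact.
  apply: subclosed_compact Scl co _ => v Sv i.
  by have := bnd _ Sv (enum_val i); rewrite /fn enum_valK in_itv.
have S0 : S !=set0.
  exists (\row_i w0 (enum_val i)) => j; rewrite sumE.
  apply: le_trans (f0 j); rewrite le_eqVlt; apply/orP; left; apply/eqP.
  rewrite [RHS](reindex (@enum_val T xpredT)) /=; last first.
    by apply: onW_bij; exact: enum_val_bij.
  by apply: eq_bigr => i _; rewrite mxE.
have [v] := @EVT_max_rV R n (fun v => \sum_(i < n) 1 * v ord0 i) S S0 Sco
  (@continuous_subspaceT _ _ _ _ (@continuous_linear_form R n (fun=> 1))).
rewrite inE => Sv vmax; exists (fn v) => // w' fw'.
have := vmax (\row_i w' (enum_val i)).
have tot (v' : 'rV[R]_n) : \sum_(i < n) 1 * v' ord0 i = \sum_t fn v' t.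
  by rewrite -(sumE (fun=> 1)); apply: eq_bigr => t _; rewrite mul1r.
have E : fn (\row_i w' (enum_val i)) = w'.
  by apply/funext => t; rewrite /fn mxE enum_rankK.
by rewrite inE !tot E; apply; rewrite /S /= E.
Qed.

(** * Mixing a decreasing sequence *)

Lemma abel_sum (R : comPzRingType) (r c : nat -> R) n :
  \sum_(k < n) r k * c k =
  \sum_(m < n) (r m - r m.+1) * (\sum_(k < m.+1) c k) + r n * \sum_(k < n) c k.
Proof.
elim: n => [|n IH]; first by rewrite !big_ord0 mulr0 addr0.
rewrite [LHS]big_ord_recr [in X in X + _]big_ord_recr /= IH -!addrA; congr (_ + _).
by rewrite [\sum_(k < n.+1) c k]big_ord_recr /=; ring.
Qed.

Lemma small_step (R : realFieldType) (I : finType) (x y : I -> R) :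
  (forall i, x i <= 0 /\ 0 <= y i \/ 0 < y i) ->
  exists2 e : R, 0 < e & forall i, e * x i <= y i.
Proof.
move=> H; pose S := 1 + \sum_(i | 0 < y i) `|x i| / y i.
have S0 : 0 < S.
  rewrite ltr_pwDl // sumr_ge0 // => i yi.
  by rewrite divr_ge0 // ltW.
exists S^-1; first by rewrite invr_gt0.
move=> i; have [[xi yi]|yi] := H i.
  by apply: le_trans yi; rewrite pmulr_rle0 // invr_gt0.
rewrite mulrC ler_pdivrMr //.
apply: le_trans (ler_norm _) _.
rewrite mulrC -ler_pdivrMr //.
rewrite /S (bigD1 i) //= addrCA lerDl addr_ge0 // sumr_ge0 // => j /andP[yj _].
by rewrite divr_ge0 // ltW.
Qed.

Section Mixing.
Variables (R : realType) (K N : nat) (g : nat -> R).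
Hypothesis K2 : (2 < K)%N.
Hypothesis NK : (2 * K ^ 2 <= N)%N.
Hypothesis g_decr : forall k, g k.+1 <= g k.
Hypothesis gN : g N.+1 = 0.
Let c (k : nat) : R := K%:R * k%:R - N%:R.
Hypothesis g_mean : 0 <= \sum_(k < N.+1) g k * c k.

(* Four families of linear constraints on the weights of tuples: nonnegative,
   zero on tuples of small sum, and remainder decreasing with mean at least
   N / K. The last is measured by the functional with coefficients c. *)
Let T : finType := {ffun 'I_K -> 'I_N.+1}.
Let cnt (t : T) (k : nat) : R := (\sum_(i < K) (t i == k :> nat))%:R.
Let adm (t : T) : bool := (N <= \sum_(i < K) t i + 2 * K)%N.
Let J : finType := (T + T + 'I_N.+1 + unit)%type.
Let a (j : J) (t : T) : R :=
  match j with
  | inl (inl (inl s)) => - (s == t)%:R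
  | inl (inl (inr s)) => if adm s then 0 else (s == t)%:R
  | inl (inr k) => cnt t k - cnt t k.+1
  | inr _ => \sum_(k < N.+1) cnt t k * c k
  end.
Let bd (j : J) : R :=
  match j with
  | inl (inl _) => 0
  | inl (inr k) => g k - g k.+1
  | inr _ => \sum_(k < N.+1) g k * c k
  end.
Let rest (w : T -> R) (k : nat) : R := g k - \sum_t cnt t k * w t.
Let feasible (w : T -> R) := forall j, \sum_t a j t * w t <= bd j.

Let sum_delta (s : T) (w : T -> R) : \sum_t (s == t)%:R * w t = w s.
Proof.
rewrite (bigD1 s) //= eqxx mul1r big1 ?addr0 // => t ts.
by rewrite eq_sym (negbTE ts) mul0r.
Qed.

Let cntN t : cnt t N.+1 = 0.
Proof.
rewrite /cnt big1 // => i _; apply/eqP; rewrite eqb0.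
by have := ltn_ord (t i); lia.
Qed.

Let restN w : rest w N.+1 = 0.
Proof. by rewrite /rest gN big1 ?subr0 // => t _; rewrite cntN mul0r. Qed.

Let feasibleP w : feasible w <->
  [/\ forall t, 0 <= w t, forall t, ~~ adm t -> w t <= 0,
      forall k, (k <= N)%N -> rest w k.+1 <= rest w k
    & 0 <= \sum_(k < N.+1) rest w k * c k].
Proof.
have E3 (k : nat) : \sum_t (cnt t k - cnt t k.+1) * w t <= g k - g k.+1 <->
   rest w k.+1 <= rest w k.
  under eq_bigr do rewrite mulrBl.
  by rewrite sumrB /rest; split; lra.
have E4 : \sum_(k < N.+1) rest w k * c k =
   \sum_(k < N.+1) g k * c k - \sum_t (\sum_(k < N.+1) cnt t k * c k) * w t.
  under [X in _ = _ - X]eq_bigr do rewrite mulr_suml.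
  rewrite exchange_big /= -sumrB; apply: eq_bigr => k _.
  rewrite /rest mulrBl; congr (_ - _); rewrite mulr_suml.
  by apply: eq_bigr => t _; ring.
split=> [fw|[w0 wa wr wm]].
- split.
  + move=> t; have := fw (inl (inl (inl t))); rewrite /= /bd.
    under eq_bigr do rewrite mulNr.
    by rewrite sumrN sum_delta oppr_le0.
  + move=> t nt; have := fw (inl (inl (inr t))); rewrite /= /bd (negbTE nt).
    by rewrite sum_delta.
  + move=> k kN; have := fw (inl (inr (Ordinal (kN : (k < N.+1)%N)))).
    by rewrite /= => /E3.
  + by have := fw (inr tt); rewrite E4 subr_ge0.
- move=> [[[t|t]|k]|u] /=.
  + under eq_bigr do rewrite mulNr.
    by rewrite sumrN sum_delta oppr_le0.
  + case: (boolP (adm t)) => ta; last by rewrite sum_delta; exact: wa.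
    by rewrite big1 // => s _; rewrite mul0r.
  + by apply/E3/wr; rewrite -ltnS.
  + by rewrite -subr_ge0 -E4.
Qed.

Let rest_ge0 w k : feasible w -> (k <= N.+1)%N -> 0 <= rest w k.
Proof.
move=> /feasibleP[_ _ wr _] kN.
have -> : k = (N.+1 - (N.+1 - k))%N by lia.
elim: (N.+1 - k)%N => [|m IH]; first by rewrite subn0 restN.
have [mN|mN] := leqP m N; last first.
  by move: IH; have -> : (N.+1 - m = N.+1 - m.+1)%N by lia.
apply: le_trans IH _; have -> : (N.+1 - m = (N.+1 - m.+1).+1)%N by lia.
by apply: wr; lia.
Qed.

Let g_le0 k : g k <= g 0%N.
Proof. by elim: k => // k; apply: le_trans. Qed.

Let feasible_bound w : feasible w -> forall t, - g 0%N <= w t <= g 0%N.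
Proof.
move=> fw t; have /feasibleP[w0 _ _ _] := fw.
have K0 : (0 < K)%N by lia.
pose k := t (Ordinal K0).
have g00 : 0 <= g 0%N by rewrite -gN g_le0.
apply/andP; split; first by apply: le_trans (w0 t); rewrite oppr_le0.
have := rest_ge0 fw (ltnW (ltn_ord k)); rewrite /rest subr_ge0 => H.
apply: le_trans (g_le0 k); apply: le_trans H.
rewrite (bigD1 t) //=; apply: ler_wpDr.
  by apply: sumr_ge0 => s _; rewrite mulr_ge0 // /cnt ler0n.
rewrite ler_peMl // /cnt (bigD1 (Ordinal K0)) //= eqxx natrD.
by rewrite lerDl ler0n.
Qed.

Let Csum m : 2 * (\sum_(k < m.+1) c k) = m.+1%:R * (K%:R * m%:R - 2 * N%:R).
Proof.
elim: m => [|m IH]; first by rewrite big_ord_recr big_ord0 /c /=; ring.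
rewrite big_ord_recr /= mulrDr IH /c -![in LHS]natr1 -![in RHS]natr1; ring.
Qed.

Let sum_cnt (t : T) (f : nat -> R) : \sum_(k < N.+1) cnt t k * f k = \sum_i f (t i).
Proof.
rewrite /cnt; under eq_bigr do rewrite natr_sum mulr_suml.
rewrite exchange_big /=; apply: eq_bigr => i _.
rewrite (bigD1 (t i)) //= eqxx mul1r big1 ?addr0 // => k.
by rewrite eq_sym -val_eqE /= => /negbTE ->; rewrite mul0r.
Qed.

(** A family of tuples like a block contradicts maximality of w. Each of its two
    defects (drops of the occupancy, mean above N / K) may occur where the
    corresponding constraint on the remainder is slack. *)
Let augment w (M : nat) (tau : nat -> nat -> nat) : feasible w ->
  (forall w', feasible w' -> \sum_t w' t <= \sum_t w t) ->
  (0 < M)%N ->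
  (forall y i, (y < M -> i < K -> tau y i <= N)%N) ->
  (forall y, (y < M -> N <= \sum_(i < K) tau y i + 2 * K)%N) ->
  ((\sum_(y < M) \sum_(i < K) tau y i <= M * N)%N \/
     0 < \sum_(k < N.+1) rest w k * c k) ->
  (forall k, (k <= N)%N -> (occupancy M K tau k <= occupancy M K tau k.+1)%N \/
      rest w k.+1 < rest w k) -> False.
Proof.
move=> fw wmax M0 tauN tauadm Hmean Hocc.
have /feasibleP[w0 wa wr wm] := fw.
pose tt' (y : 'I_M) : T := [ffun i : 'I_K => inord (tau y i)].
have tt'E (y : 'I_M) (i : 'I_K) : tt' y i = tau y i :> nat.
  by rewrite ffunE inordK // ltnS; exact: tauN.
pose be (t : T) : R := \sum_(y < M) (tt' y == t)%:R.
have sum_be (f : T -> R) : \sum_t f t * be t = \sum_(y < M) f (tt' y).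
  rewrite /be; under eq_bigr do rewrite mulr_sumr.
  rewrite exchange_big /=; apply: eq_bigr => y _.
  by rewrite -(sum_delta (tt' y) f); apply: eq_bigr => t _; rewrite mulrC.
have occE k : \sum_t cnt t k * be t = (occupancy M K tau k)%:R.
  rewrite sum_be /occupancy natr_sum; apply: eq_bigr => y _.
  by rewrite /cnt; congr (_%:R); apply: eq_bigr => i _; rewrite tt'E.
have meanE : \sum_(k < N.+1) (\sum_t cnt t k * be t) * c k =
    K%:R * ((\sum_(y < M) \sum_(i < K) tau y i)%:R - (M * N)%:R).
  under eq_bigr do rewrite mulr_suml.
  rewrite exchange_big /=.
  under eq_bigr => t _.
    under eq_bigr => k _ do rewrite mulrAC.
    rewrite -mulr_suml sum_cnt; over.
  rewrite sum_be.
  have E (y : 'I_M) : \sum_i c (tt' y i) = K%:R * ((\sum_(i < K) tau y i)%:R - N%:R).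
    rewrite /c sumrB natr_sum mulrBr mulr_sumr sumr_const card_ord mulr_natl.
    by congr (_ - _); apply: eq_bigr => i _; rewrite tt'E.
  rewrite (eq_bigr _ (fun y _ => E y)).
  rewrite -mulr_sumr sumrB sumr_const card_ord; congr (_ * (_ - _)).
    by rewrite natr_sum.
  by rewrite natrM mulr_natl.
pose x (j : option 'I_N.+1) : R := match j with
  | Some k => (occupancy M K tau k)%:R - (occupancy M K tau k.+1)%:R
  | None => K%:R * ((\sum_(y < M) \sum_(i < K) tau y i)%:R - (M * N)%:R) end.
pose z (j : option 'I_N.+1) : R := match j with
  | Some k => rest w k - rest w k.+1
  | None => \sum_(k < N.+1) rest w k * c k end.
have [j|e e0 He] := @small_step R _ x z.
  case: j => [k|] /=.
    have kN : (k <= N)%N by rewrite -ltnS.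
    case: (Hocc k kN) => H; [left|right]; last by rewrite subr_gt0.
    by rewrite subr_le0 ler_nat subr_ge0 wr.
  case: Hmean => H; [left|by right]; split => //.
  by rewrite pmulr_rle0 ?subr_le0 ?ler_nat // ltr0n; lia.
pose w' t := w t + e * be t.
have be0 t : 0 <= be t by apply: sumr_ge0.
have restE k : rest w' k = rest w k - e * (\sum_t cnt t k * be t).
  rewrite /rest /w'; under eq_bigr do rewrite mulrDr.
  rewrite big_split /= opprD addrA; congr (_ - _).
  by rewrite mulr_sumr; apply: eq_bigr => t _; rewrite mulrCA.
have fw' : feasible w'.
  apply/feasibleP; split.
  - by move=> t; rewrite /w' addr_ge0 // mulr_ge0 // ltW.
  - move=> t nt; rewrite /w' (_ : be t = 0) ?mulr0 ?addr0; first exact: wa.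
    rewrite /be big1 // => y _; case: eqP => // E; case/negP: nt.
    rewrite /adm -E (eq_bigr (fun i : 'I_K => tau y i)); first exact: tauadm.
    by move=> i _; rewrite tt'E.
  - move=> k kN; rewrite !restE !occE.
    by have := He (Some (Ordinal (kN : (k < N.+1)%N))); rewrite /x /z /=; lra.
  - under eq_bigr do rewrite restE mulrBl -mulrA.
    rewrite sumrB -mulr_sumr meanE subr_ge0.
    exact: (He None).
have := wmax _ fw'; rewrite /w' big_split /= gerDl -mulr_sumr.
apply/negP; rewrite -ltNge mulr_gt0 //.
have := sum_be (fun=> 1); under eq_bigr do rewrite mul1r.
by move=> ->; rewrite sumr_const card_ord pmulrn_lgt0.
Qed.

(** Weights of maximal total mass leave no remainder: after Abel summation the
    mean functional of the remainder is a sum, over its drops m, of terms with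
    the sign of K m - 2 N, so that a nonzero remainder drops at some b with
    K b >= 2 N. *)
Lemma decreasing_mix : exists w : {ffun 'I_K -> 'I_N.+1} -> R,
  [/\ forall t, 0 <= w t,
      forall t, 0 < w t -> (N <= \sum_(i < K) t i + 2 * K)%N
    & forall k, (k <= N)%N ->
        \sum_t w t * (\sum_(i < K) (t i == k :> nat))%:R = g k].
Proof.
have f0 : feasible (fun=> 0).
  have E k : rest (fun=> 0) k = g k.
    by rewrite /rest big1 ?subr0 // => t _; rewrite mulr0.
  apply/feasibleP; split => //; first by move=> k _; rewrite !E.
  by under eq_bigr do rewrite E.
have [w fw wmax] := linear_program_max feasible_bound f0.
have /feasibleP[w0 wa wr wm] := fw.
exists w; split => //.
  move=> t wt; rewrite leqNgt; apply/negP => H.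
  have : w t <= 0 by apply: wa; rewrite /adm -ltnNge.
  by rewrite leNgt wt.
have dge0 k : (k <= N)%N -> 0 <= rest w k - rest w k.+1 by move=> /wr; rewrite subr_ge0.
suff r0 : rest w 0%N <= 0.
  move=> k kN; have : rest w k = 0.
    apply/eqP; rewrite eq_le rest_ge0 ?andbT //; last by lia.
    apply: le_trans r0; elim: k kN => // k IH kN.
    by apply: le_trans (IH (ltnW kN)); apply: wr; lia.
  rewrite /rest => /eqP; rewrite subr_eq0 => /eqP ->.
  by apply: eq_bigr => t _; rewrite mulrC.
rewrite leNgt; apply/negP => r0.
have meanE : 2 * (\sum_(k < N.+1) rest w k * c k) =
    \sum_(m < N.+1) (rest w m - rest w m.+1) * (m.+1%:R * (K%:R * m%:R - 2 * N%:R)).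
  rewrite abel_sum restN mul0r addr0 mulr_sumr; apply: eq_bigr => m _.
  by rewrite mulrCA Csum.
have [m mN dm] : exists2 m, (m <= N)%N & 0 < rest w m - rest w m.+1.
  apply: contrapT => H.
  have E k : (k <= N.+1)%N -> rest w k = rest w 0%N.
    elim: k => // k IH kN; rewrite -IH; last exact: ltnW.
    apply/eqP; rewrite eq_le; apply/andP; split; first exact: wr.
    rewrite leNgt; apply/negP => H'; apply: H; exists k => //.
    by rewrite subr_gt0.
  by move: r0; rewrite -(E N.+1) // restN ltxx.
have [b [bN db Nb]] : exists b, [/\ (b <= N)%N, 0 < rest w b - rest w b.+1 & (2 * N <= K * b)%N].
  apply: contrapT => H.
  have Hm k : (k <= N)%N -> 0 < rest w k - rest w k.+1 -> K%:R * k%:R - 2 * N%:R < 0 :> R.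
    move=> kN dk; rewrite subr_lt0 -!natrM ltr_nat ltnNge; apply/negP => h.
    by apply: H; exists k.
  have : \sum_(m < N.+1) (rest w m - rest w m.+1) * (m.+1%:R * (K%:R * m%:R - 2 * N%:R)) < 0.
    rewrite (bigD1 (Ordinal (mN : (m < N.+1)%N))) //= ltr_nwDl //.
      by rewrite pmulr_rlt0 // pmulr_rlt0 ?ltr0n // Hm.
    rewrite sumr_le0 // => k _.
    have kN : (k <= N)%N by rewrite -ltnS.
    have := dge0 _ kN; rewrite le_eqVlt => /orP[/eqP <-|dk]; first by rewrite mul0r.
    by rewrite pmulr_rle0 // pmulr_rle0 ?ltr0n // ltW // Hm.
  by rewrite -meanE pmulr_rlt0 // ltNge wm.
(* If the mean is strictly above N / K, the constant tuple b can be added;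
   otherwise there is also a drop at some a with K a <= 2 N. *)
move: wm; rewrite le_eqVlt => /orP[/eqP wm|wm]; last first.
  apply: (@augment w 1 (fun _ _ => b)) => //.
  - by move=> y _; rewrite sum_nat_const card_ord; lia.
  - by right.
  - move=> k kN; have [->|kb] := eqVneq k b; first by right; rewrite -subr_gt0.
    left; rewrite /occupancy !big_ord_recr !big_ord0 /= !add0n.
    by rewrite big1 // => i _; rewrite eq_sym (negbTE kb).
have [a' [aN da Na]] : exists a, [/\ (a <= N)%N, 0 < rest w a - rest w a.+1 & (K * a <= 2 * N)%N].
  apply: contrapT => H.
  have Hm k : (k <= N)%N -> 0 < rest w k - rest w k.+1 -> 0 < K%:R * k%:R - 2 * N%:R :> R.
    move=> kN dk; rewrite subr_gt0 -!natrM ltr_nat ltnNge; apply/negP => h.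
    by apply: H; exists k.
  have : 0 < \sum_(m < N.+1) (rest w m - rest w m.+1) * (m.+1%:R * (K%:R * m%:R - 2 * N%:R)).
    rewrite (bigD1 (Ordinal (mN : (m < N.+1)%N))) //= ltr_pwDl //.
      by rewrite pmulr_rgt0 // pmulr_rgt0 ?ltr0n // Hm.
    rewrite sumr_ge0 // => k _.
    have kN : (k <= N)%N by rewrite -ltnS.
    have := dge0 _ kN; rewrite le_eqVlt => /orP[/eqP <-|dk]; first by rewrite mul0r.
    by rewrite pmulr_rge0 // pmulr_rge0 ?ltr0n // ltW // Hm.
  by rewrite -meanE -wm mulr0 ltxx.
have [M [tau [M0 tN tadm tmean tocc]]] := block_exists K2 NK Na Nb bN.
apply: (@augment w M tau) => //; first by left.
move=> k kN; have [->|ka] := eqVneq k a'; first by right; rewrite -subr_gt0.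
have [->|kb] := eqVneq k b; first by right; rewrite -subr_gt0.
by left; exact: tocc.
Qed.

End Mixing.

(** * Atomless probability spaces *)

Section RealProbability.
Context (d : measure_display) (T : measurableType d) (R : realType) (P : probability T R).

Definition pr (A : set T) : R := fine (P A).

Lemma prE A : measurable A -> P A = (pr A)%:E.
Proof. by move=> mA; rewrite fineK // fin_num_measure. Qed.

Lemma pr_ge0 A : 0 <= pr A.
Proof. by rewrite fine_ge0. Qed.

Lemma pr_le A B : measurable A -> measurable B -> A `<=` B -> pr A <= pr B.
Proof. by move=> mA mB AB; rewrite -lee_fin -!prE // le_measure // inE. Qed.

Lemma prT : pr setT = 1.
Proof. by rewrite /pr probability_setT. Qed.

Lemma pr0 : pr set0 = 0.
Proof. by rewrite /pr measure0. Qed.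

Lemma prU A B : measurable A -> measurable B -> A `&` B = set0 ->
  pr (A `|` B) = pr A + pr B.
Proof.
move=> mA mB AB; apply: EFin_inj.
by rewrite EFinD -!prE //; [rewrite measureU | exact: measurableU].
Qed.

Lemma prD A B : measurable A -> measurable B -> B `<=` A ->
  pr (A `\` B) = pr A - pr B.
Proof.
move=> mA mB BA; have mAB := measurableD mA mB.
rewrite -[A in RHS](@setDUK _ B A) // prU //; first by rewrite addrAC subrr add0r.
by rewrite setDIK.
Qed.

Lemma measurable_sublevel (f : T -> R) (x : R) :
  measurable_fun setT f -> measurable [set t | f t <= x].
Proof.
move=> mf; rewrite (_ : [set t | _] = f @^-1` `]-oo, x]); last first.
  by apply/seteqP; split => t /=; rewrite in_itv.
by rewrite -[X in measurable X]setTI; exact: mf.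
Qed.

End RealProbability.

Section Atomless.
Context (d : measure_display) (T : measurableType d) (R : realType) (P : probability T R).
Hypothesis P_atomless : atomless P.
Local Notation p := (pr P).

(** One of the two parts of a proper splitting has at most half the probability;
    iterate. *)
Lemma atomless_small A (e : R) : measurable A -> 0 < p A -> 0 < e ->
  exists B, [/\ measurable B, B `<=` A, 0 < p B & p B <= e].
Proof.
move=> mA pA e0.
have H (n : nat) : exists B, [/\ measurable B, B `<=` A, 0 < p B & p B <= p A / 2 ^+ n].
  elim: n => [|n [B [mB BA pB0 pBn]]]; first by exists A; split => //; rewrite expr0 divr1.
  have PB : (0 < P B)%E by rewrite prE // lte_fin.
  have [C [mC CB]] := P_atomless mB PB; rewrite !prE // !lte_fin => pC0 pCB.
  have h : p A / 2 ^+ n.+1 = p A / 2 ^+ n / 2 by rewrite exprSr invfM mulrA.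
  have [hC|hC] := leP (p C) (p B / 2).
    exists C; split => //; first exact: subset_trans BA.
    by rewrite h; apply: le_trans hC _; rewrite ler_pM2r.
  exists (B `\` C); split => //.
  - exact: measurableD.
  - by move=> x [/BA].
  - by rewrite prD // subr_gt0.
  - by rewrite prD // h; lra.
have [n hn] : exists n : nat, p A / 2 ^+ n <= e.
  have hn := archi_boundP (ltW (divr_gt0 pA e0)).
  set n := Num.bound _ in hn; exists n.
  rewrite ler_pdivrMr ?exprn_gt0 // mulrC -ler_pdivrMr //.
  apply: le_trans (ltW hn) _.
  by rewrite -natrX ler_nat ltnW // ltn_expl.
have [B [mB BA pB pBn]] := H n.
by exists B; split => //; apply: le_trans hn.
Qed.

(** Sierpinski's theorem, by exhaustion: repeatedly add a subset of the rest that
    still fits and has at least half the largest possible probability. Were the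
    limit smaller than t, a fixed small set would fit at every step, and the
    probabilities would grow without bound. *)
Lemma atomless_split A (t : R) : measurable A -> 0 <= t <= p A ->
  exists B, [/\ measurable B, B `<=` A & p B = t].
Proof.
move=> mA /andP[t0 tA].
pose ok B := [/\ measurable B, B `<=` A & p B <= t].
pose fits B C := [/\ measurable C, C `<=` A `\` B & p B + p C <= t].
have step B : exists C, ok B -> fits B C /\ forall D, fits B D -> p D <= 2 * p C.
  have [oB|nB] := pselect (ok B); last by exists set0.
  have [mB BA pB] := oB.
  pose S := [set p D | D in fits B].
  have f0 : fits B set0 by split; [exact: measurable0|exact: sub0set|rewrite pr0 addr0].
  have supS : has_sup S.
    split; first by exists (p set0), set0.
    by exists t => _ [D [mD _ h] <-]; have := pr_ge0 P B; lra.
  have S0 : 0 <= sup S by rewrite -(pr0 P); apply: ub_le_sup; [exact: supS.2|exists set0].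
  have ubS D : fits B D -> p D <= sup S.
    by move=> fD; apply: ub_le_sup; [exact: supS.2|exists D].
  have [S1|S1] := ltP 0 (sup S).
    have h : 0 < sup S / 2 by rewrite divr_gt0.
    have [_ [C fC <-] hC] := sup_adherent h supS.
    exists C => _; split => // D /ubS; lra.
  by exists set0 => _; split => // D /ubS; rewrite pr0; lra.
have [nxt Hnxt] := choice step.
pose B := fix B n := if n is n'.+1 then B n' `|` nxt (B n') else set0.
have okB n : ok (B n).
  elim: n => [|n IH]; first by split; [exact: measurable0|exact: sub0set|rewrite pr0].
  have [[mC CA h] _] := Hnxt _ IH; have [mB BA pB] := IH.
  split => /=.
  - exact: measurableU.
  - by move=> x [/BA//|/CA[]].
  - by rewrite prU //; apply/seteqP; split => // x [Bx /CA[]].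
have Binc : nondecreasing_seq B.
  by apply/nondecreasing_seqP => n; rewrite subsetEset => x; left.
pose BB := \bigcup_n B n.
have mBn n : measurable (B n) by have [] := okB n.
have mBB : measurable BB by exact: bigcup_measurable.
have BBA : BB `<=` A by move=> x [n _]; have [_ + _] := okB n; apply.
have pBB : p BB <= t.
  have cv := @nondecreasing_cvg_mu _ _ _ P _ mBn mBB Binc.
  rewrite -lee_fin -prE //.
  rewrite -(cvg_lim _ cv) //; apply: lime_le; first by apply/cvg_ex; exists (P BB).
  by apply: nearW => n /=; rewrite prE // lee_fin; have [] := okB n.
exists BB; split => //; apply/eqP; rewrite eq_le pBB /= leNgt; apply/negP => lt.
have mAB : measurable (A `\` BB) by exact: measurableD.
have pAB : 0 < p (A `\` BB) by rewrite prD // subr_gt0 (lt_le_trans lt).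
have e0 : 0 < t - p BB by rewrite subr_gt0.
have [D [mD DA pD pDt]] := atomless_small mAB pAB e0.
have fD n : fits (B n) D.
  split => //.
    by move=> x /DA[Ax nx]; split => // Bx; apply: nx; exists n.
  have : p (B n) <= p BB by apply: pr_le => //; move=> x Bx; exists n.
  by lra.
have grow n : n%:R * p D <= 2 * p (B n).
  elim: n => [|n IH]; first by rewrite mul0r mulr_ge0 // pr_ge0.
  have [[mC CA h] hC] := Hnxt _ (okB n).
  rewrite /= prU //; last by apply/seteqP; split => // x [Bx /CA[]].
  have := hC _ (fD n); rewrite -natr1; lra.
have [n hn] : exists n : nat, 2 * t < n%:R * p D.
  have : 0 <= 2 * t / p D by rewrite divr_ge0 ?mulr_ge0 // ltW.
  by move=> /archi_boundP; rewrite ltr_pdivrMr // => h; exists (Num.bound (2 * t / p D)).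
have := grow n; have [_ _] := okB n; lra.
Qed.

End Atomless.

Section UniformVariable.
Context (d : measure_display) (T : measurableType d) (R : realType) (P : probability T R).
Hypothesis P_atomless : atomless P.
Local Notation p := (pr P).

(** F n j is an increasing chain of events of probability j / 2^n, refined by
    halving the increments, and V is the supremum of the dyadic levels whose
    event does not contain the point. *)
Lemma uniform_exists : exists V : T -> R,
  [/\ measurable_fun setT V, forall w, 0 <= V w <= 1
    & forall x, 0 <= x <= 1 -> p [set w | V w <= x] = x].
Proof.
have /choice[half Hhalf] A : exists B, measurable A ->
    [/\ measurable B, B `<=` A & p B = p A / 2].
  have [mA|] := pselect (measurable A); last by exists set0.
  have [|B HB] := @atomless_split _ _ _ P P_atomless A (p A / 2) mA.
    by have := pr_ge0 P A; lra.
  by exists B.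
pose F := fix F n j : set T := if n is n'.+1 then
    (if odd j then F n' j./2 `|` half (F n' j./2.+1 `\` F n' j./2) else F n' j./2)
  else if j is 0%N then set0 else setT.
have F0 n : F n 0%N = set0 by elim: n.
have F2 n j : F n.+1 j.*2 = F n j by rewrite /= odd_double doubleK.
have F2S n j : F n.+1 j.*2.+1 = F n j `|` half (F n j.+1 `\` F n j).
  by rewrite /= odd_double /= uphalf_double.
have jcase (j : nat) : j = j./2.*2 \/ j = j./2.*2.+1.
  by case: (boolP (odd j)) => oj; [right|left]; lia.
have mF n j : measurable (F n j).
  elim: n j => [|n IH] j; first by case: j => [|j]; [exact: measurable0|exact: measurableT].
  have [->|->] := jcase j; rewrite ?F2 ?F2S //.
  by apply: measurableU => //; have [] := Hhalf _ (measurableD (IH j./2.+1) (IH j./2)).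
have FS n j : F n j `<=` F n j.+1.
  elim: n j => [|n IH] j; first by case: j => [|j] w.
  have [->|->] := jcase j.
    by rewrite F2 F2S; left.
  rewrite -doubleS F2 F2S => w [/IH //|].
  by have [_ + _] := Hhalf _ (measurableD (mF n j./2.+1) (mF n j./2)) => /[apply] -[].
have Fmono n i j : (i <= j)%N -> F n i `<=` F n j.
  by move=> ij; rewrite -(subnKC ij); elim: (j - i)%N => [|k IH];
    rewrite ?addn0 // addnS => w /IH /FS.
have Fscale n k j : F (n + k)%N (j * 2 ^ k)%N = F n j.
  elim: k => [|k IH]; first by rewrite addn0 expn0 muln1.
  by rewrite addnS expnS mulnCA mul2n F2.
have Fcmp n m i j : (j * 2 ^ m <= i * 2 ^ n)%N -> F n j `<=` F m i.
  by move=> h; rewrite -(Fscale n m) -(Fscale m n) addnC; exact: Fmono.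
have FT n j : (2 ^ n <= j)%N -> F n j = setT.
  move=> h; apply/seteqP; split => // w _.
  by apply: (@Fcmp 0%N n _ 1%N); rewrite ?expn0 ?muln1 ?mul1n.
have pF n j : (j <= 2 ^ n)%N -> p (F n j) = j%:R / 2 ^+ n.
  elim: n j => [|n IH] j.
    by case: j => [|[|j]] // _; rewrite /= ?pr0 ?prT ?mul0r // expr0 divr1.
  have h2 : (2 ^+ n.+1 : R) = 2 * 2 ^+ n by rewrite exprS.
  have n0 : (2 ^+ n : R) != 0 by rewrite expf_neq0.
  have [jE|jE] := jcase j; rewrite expnS => jn.
    rewrite jE F2 IH; last lia.
    by rewrite h2 -muln2 natrM; field.
  have [mh hs ph] := Hhalf _ (measurableD (mF n j./2.+1) (mF n j./2)).
  rewrite jE F2S prU //; last first.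
    by apply/seteqP; split => // w [h1 /hs[]].
  rewrite ph prD // !IH; [|lia..].
  by rewrite h2 -muln2 -[in RHS]natr1 -[in LHS]natr1 natrM; field.
pose S w := [set x : R | exists n j, [/\ (j <= 2 ^ n)%N, ~ F n j w & x = j%:R / 2 ^+ n]].
have e2 n : 0 < 2 ^+ n :> R by rewrite exprn_gt0.
have S0 w : S w 0 by exists 0%N, 0%N; split => //; rewrite mul0r.
have S1 w x : S w x -> x <= 1.
  move=> [n [j [jn _ ->]]]; rewrite ler_pdivrMr // mul1r -natrX ler_nat //.
have supS w : has_sup (S w) by split; [exists 0|exists 1 => x; exact: S1].
pose V w := sup (S w).
have V_lex w x : V w <= x <-> (forall n j, (j <= 2 ^ n)%N -> x < j%:R / 2 ^+ n -> F n j w).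
  split.
    move=> Vx n j jn xj; apply: contrapT => nF.
    have : j%:R / 2 ^+ n <= V w by apply: ub_le_sup; [exact: (supS w).2|exists n, j].
    by move=> h; move: xj; rewrite ltNge (le_trans h).
  move=> H; apply: ge_sup; first by exists 0.
  move=> _ [n [j [jn nF ->]]]; rewrite leNgt; apply/negP => h.
  by apply: nF; exact: H.
have V01 w : 0 <= V w <= 1.
  rewrite ub_le_sup //=; last exact: (supS w).2.
  by apply: ge_sup; [exists 0|exact: S1].
have mV x : measurable [set w | V w <= x].
  have -> : [set w | V w <= x] =
     \bigcap_n \bigcap_(j in [set j | (j <= 2 ^ n)%N && (x < j%:R / 2 ^+ n)]) F n j.
    apply/seteqP; split => w /=.
      by move=> /V_lex h n _ j /= /andP[]; exact: h.
    by move=> h; apply/V_lex => n j jn xj; apply: (h n) => //=; rewrite jn.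
  apply: bigcapT_measurable => n; apply: bigcap_measurableType => j _; exact: mF.
exists V; split => //.
- apply: (measurability _ (measurable_realfun.RGenOInfty.measurableE R)) => //.
  move=> _ [_ [x ->] <-]; rewrite setTI.
  rewrite (_ : _ @^-1` _ = ~` [set w | V w <= x]); first exact: measurableC.
  by apply/seteqP; split => w /=; rewrite in_itv /= andbT ltNge => /negP.
- move=> x /andP[x0 x1].
  have up n : p [set w | V w <= x] <= x + (2 ^+ n)^-1.
    pose j := (Num.trunc (x * 2 ^+ n)).+1.
    have xj : x * 2 ^+ n < j%:R by rewrite /j; exact: truncnS_gt.
    have jx : j%:R <= x * 2 ^+ n + 1.
      by rewrite /j -natr1 lerD2r truncn_le // mulr_ge0 // ltW.
    have [jn|jn] := leqP j (2 ^ n)%N; last first.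
      apply: le_trans (_ : 1 <= _); first by rewrite -(prT P); apply: pr_le.
      have : (2 ^ n).+1%:R <= j%:R :> R by rewrite ler_nat.
      rewrite -natr1 natrX => h.
      have : x = 1.
        apply/eqP; rewrite eq_le x1 /=.
        by rewrite -(ler_pM2r (e2 n)) mul1r; lra.
      by move=> ->; rewrite lerDl invr_ge0 ltW.
    apply: le_trans (_ : p (F n j) <= _).
      apply: pr_le => // w /= /V_lex; apply => //.
      by rewrite ltr_pdivlMr.
    rewrite pF // ler_pdivrMr // mulrDl mulVf //; exact: lt0r_neq0.
  have low n : x - (2 ^+ n)^-1 <= p [set w | V w <= x].
    pose j := Num.trunc (x * 2 ^+ n).
    have jx : j%:R <= x * 2 ^+ n by rewrite truncn_le // mulr_ge0 // ltW.
    have xj : x * 2 ^+ n < j.+1%:R by exact: truncnS_gt.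
    have jn : (j <= 2 ^ n)%N.
      rewrite -(ler_nat R) natrX; apply: le_trans jx _.
      by rewrite ler_piMl // ltW.
    apply: le_trans (_ : p (F n j) <= _).
      rewrite pF // ler_pdivlMr // mulrBl mulVf ?lt0r_neq0 //.
      by move: xj; rewrite -natr1; lra.
    apply: pr_le => // w Fw; apply/V_lex => m i im xi.
    apply: Fcmp Fw.
    rewrite -(ler_nat R) !natrM !natrX.
    move: xi; rewrite ltr_pdivlMr // => xi.
    apply: ltW; apply: le_lt_trans (_ : x * 2 ^+ n * 2 ^+ m < _).
      by rewrite ler_pM2r.
    by rewrite mulrAC ltr_pM2r.
  have small e : 0 < e -> exists n, (2 ^+ n)^-1 <= e :> R.
    move=> e0; have hn := archi_boundP (ltW (divr_gt0 ltr01 e0)).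
    set n := Num.bound _ in hn; exists n.
    rewrite -div1r ler_pdivrMr // mulrC -ler_pdivrMr //.
    by apply: le_trans (ltW hn) _; rewrite -natrX ler_nat ltnW // ltn_expl.
  apply/eqP; rewrite eq_le; apply/andP; split; apply/ler_addgt0Pr => e /small[n hn].
    by apply: le_trans (up n) _; rewrite lerD2l.
  by have := low n; lra.
Qed.

End UniformVariable.

(** * Uniform laws assembled from affine pieces *)

Definition clip (R : realDomainType) (x : R) : R := Num.max 0 (Num.min x 1).

Lemma clip_id (R : realDomainType) (x : R) : 0 <= x <= 1 -> clip x = x.
Proof. by move=> /andP[x0 x1]; rewrite /clip min_l // max_r. Qed.
Lemma clip_le0 (R : realDomainType) (x : R) : x <= 0 -> clip x = 0.
Proof. by move=> x0; rewrite /clip max_l // ge_min x0. Qed.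
Lemma clip_ge1 (R : realDomainType) (x : R) : 1 <= x -> clip x = 1.
Proof. by move=> x1; rewrite /clip min_r // max_r. Qed.
Lemma uniform_prob_cdf (R : realType) (x : R) :
  uniform_prob (@ltr01 R) `]-oo, x] = (clip x)%:E.
Proof.
rewrite /uniform_prob integral_uniform_pdf.
rewrite (eq_integral (fun=> 1%:E)); last first.
  move=> y; rewrite inE /= in_itv /= => -[_]; rewrite in_itv /uniform_pdf /= => ->.
  by rewrite subr0 invr1.
rewrite integral_cst //=; last exact: measurableI.
rewrite mul1e.
have [x0|x0] := ltP x 0.
  rewrite clip_le0 ?ltW // (_ : _ `&` _ = set0) ?measure0 //.
  apply/seteqP; split => // y /=; rewrite !in_itv /= => -[yx /andP[y0 _]].
  by move: (le_lt_trans y0 (le_lt_trans yx x0)); rewrite ltxx.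
have [x1|x1] := leP x 1.
  rewrite clip_id ?x0 // (_ : _ `&` _ = `[0, x]%classic).
    rewrite lebesgue_measure_itv /= lte_fin; case: ltP => h; first by rewrite sube0.
    by congr (_%:E); apply/eqP; rewrite eq_le x0 h.
  apply/seteqP; split => y /=; rewrite !in_itv /=; first by move=> [-> /andP[-> _]].
  by move=> /andP[-> h]; rewrite h (le_trans h).
rewrite clip_ge1 ?ltW // (_ : _ `&` _ = `[0, 1]%classic).
  by rewrite lebesgue_measure_itv /= lte_fin ltr01 sube0.
apply/seteqP; split => y /=; rewrite !in_itv /=; first by case.
by move=> /andP[-> h]; rewrite h (le_trans h) // ltW.
Qed.

Section UniformLaw.
Context (d : measure_display) (T : measurableType d) (R : realType) (P : probability T R).
Local Notation p := (pr P).

Lemma uniform01_le (U : {RV P >-> R}) x : uniform01 U ->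
  p [set w | U w <= x] = clip x.
Proof.
move=> [_ dU]; have := dU `]-oo, x]%classic (measurable_itv _).
rewrite uniform_prob_cdf /distribution /pushforward.
rewrite (_ : _ @^-1` _ = [set w | U w <= x]); first by rewrite /pr => ->.
by apply/seteqP; split => w /=; rewrite in_itv.
Qed.

(** Half-lines form a pi-system generating the Borel sets. *)
Lemma uniform01_of_cdf (U : {RV P >-> R}) : (forall w, U w \in `[0, 1]) ->
  (forall x, 0 <= x <= 1 -> p [set w | U w <= x] = x) -> uniform01 U.
Proof.
move=> U01 UE; split => // A mA.
have mle x : measurable [set w | U w <= x] by exact: measurable_sublevel.
have UE' x : p [set w | U w <= x] = clip x.
  have [x0|x0] := ltP x 0.
    rewrite clip_le0 ?ltW // (_ : [set _ | _] = set0) ?pr0 //.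
    apply/seteqP; split => // w /= h; have := U01 w; rewrite in_itv /= => /andP[h' _].
    by move: (le_lt_trans h' (le_lt_trans h x0)); rewrite ltxx.
  have [x1|x1] := leP x 1; first by rewrite clip_id ?x0 // UE // x0.
  rewrite clip_ge1 ?ltW // (_ : [set _ | _] = setT) ?prT //.
  apply/seteqP; split => // w _ /=; have := U01 w; rewrite in_itv /= => /andP[_ h].
  by apply: le_trans h (ltW x1).
pose G : set (set R) := [set A | exists x, A = `]x, +oo[%classic].
(* The uniform law is a measure on the copy of R whose measurable structure is
   generated by half-open intervals. *)
have mU : @measurable_fun _ _ T (measurableTypeR R) setT U.
  by move=> _ B mB; exact: (@measurable_funPT _ _ _ _ U).
pose U' : {mfun T >-> measurableTypeR R} := @mfun_Sub _ _ T (measurableTypeR R) U (mem_set mU).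
apply: (@measure_unique _ R (measurableTypeR R) G (fun n : nat => `](- n%:R : R), +oo[%classic)
  _ _ _ _ (distribution P U') (uniform_prob (@ltr01 R))) => //.
- exact: measurable_realfun.RGenOInfty.measurableE.
- move=> _ _ [x ->] [y ->]; exists (Num.max x y).
  by apply/seteqP; split => z /=; rewrite !in_itv /= !andbT gt_max => /andP.
- by move=> n; exists (- n%:R).
- apply/seteqP; split => // x _.
  exists (Num.bound x) => //; rewrite /= in_itv /= andbT; rewrite ltrNl; exact: unstable.ltrNbound.
- move=> _ [x ->].
  rewrite -setCitvl.
  have E2 : uniform_prob (@ltr01 R) (~` `]-oo, x]) = (1 - uniform_prob (@ltr01 R) `]-oo, x])%E.
    exact: (@probability_setC _ _ R (uniform_prob (@ltr01 R)) `]-oo, x]%classic (measurable_itv _)).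
  have E1 := @probability_setC _ _ R P _ (mle x).
  by apply: (eq_trans _ (esym E2)); rewrite uniform_prob_cdf -UE' -prE // -E1.
- by move=> n; rewrite (le_lt_trans (probability_le1 _ _)) ?ltry.
Qed.

End UniformLaw.

Lemma interval_pieces (R : realDomainType) (J : finType) (w : J -> R) :
  (forall j, 0 <= w j) -> \sum_j w j = 1 ->
  exists s : J -> R, [/\ forall j, 0 <= s j, forall j, s j + w j <= 1,
    forall j j' v, s j < v <= s j + w j -> s j' < v <= s j' + w j' -> j = j'
  & forall v, 0 < v <= 1 -> exists j, s j < v <= s j + w j].
Proof.
move=> w0 w1; pose r (j : J) : nat := enum_rank j.
pose s' n := \sum_(k | (r k < n)%N) w k.
have rinj j j' : r j = r j' -> j = j' by move=> /val_inj /enum_rank_inj.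
have s'S j : s' (r j).+1 = s' (r j) + w j.
  rewrite /s' (bigD1 j) //= addrC; congr (_ + _); apply: eq_bigl => k.
  rewrite ltnS [in RHS]ltn_neqAle andbC; congr (_ && _); congr (~~ _).
  by apply/eqP/eqP => [->//|/rinj].
have s'mono n m : (n <= m)%N -> s' n <= s' m.
  move=> nm; rewrite /s' !big_mkcond /= [leRHS]big_mkcond /=; apply: ler_sum => k _.
  by case: ifP => [h|_]; [rewrite (leq_trans h nm)|case: ifP].
have s'J : s' #|J| = 1 by rewrite -w1; apply: eq_bigl => k; rewrite /r ltn_ord.
have s'0 : s' 0%N = 0 by rewrite /s' big_pred0.
exists (fun j => s' (r j)); split.
- by move=> j; rewrite -s'0 s'mono.
- by move=> j; rewrite -s'S -s'J s'mono // /r ltn_ord.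
- move=> j j' v; rewrite -!s'S => /andP[h1 h2] /andP[h3 h4]; apply: rinj.
  have [h|h|//] := ltngtP (r j) (r j').
  + by have := s'mono _ _ h; rewrite leNgt (lt_le_trans h3).
  + by have := s'mono _ _ h; rewrite leNgt (lt_le_trans h1).
- move=> v /andP[v0 v1].
  have ex : exists n, v <= s' n by exists #|J|; rewrite s'J.
  case: (ex_minnP ex) => -[|n]; first by rewrite s'0 leNgt v0.
  move=> vn nmin.
  have nJ : (n < #|J|)%N by apply: nmin; rewrite s'J.
  exists (enum_val (Ordinal nJ)); have rE : r (enum_val (Ordinal nJ)) = n.
    by rewrite /r enum_valK.
  rewrite -s'S rE vn andbT ltNge; apply/negP => h.
  by have := nmin _ h; rewrite ltnn.
Qed.

Section Assembly.
Context (d : measure_display) (T : measurableType d) (R : realType) (P : probability T R).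
Hypothesis P_atomless : atomless P.
Local Notation p := (pr P).

Lemma pr_bigU (J : choiceType) (s : seq J) (B : J -> set T) : uniq s ->
  (forall j, measurable (B j)) ->
  (forall j j', j != j' -> B j `&` B j' = set0) ->
  p (\big[setU/set0]_(j <- s) B j) = \sum_(j <- s) p (B j).
Proof.
move=> us mB dB; elim: s us => [_|j s IH /= /andP[js us]]; first by rewrite !big_nil pr0.
rewrite !big_cons prU //; first by rewrite IH.
  exact: bigsetU_measurable.
rewrite -bigcup_seq; apply/seteqP; split => // x [Bj [j' /= j's Bj']].
have /eqP jj' : j == j'.
  by rewrite -[_ == _]negbK; apply/negP => /dB h; have : (B j `&` B j') x by []; rewrite h.
by move: js; rewrite jj' j's.
Qed.

Definition place (R : realType) (rev : bool) (l lam y : R) : R :=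
  l + lam * (if rev then 1 - y else y).

(** On the event that V falls into an interval of length w, the affine image of V
    onto [l, l + lam], in either direction, is uniform there with mass w. *)
Lemma piece_cdf (V : T -> R) (s w : R) (rev : bool) (l lam x : R) :
  measurable_fun setT V ->
  (forall x, 0 <= x <= 1 -> p [set t | V t <= x] = x) ->
  (forall t, 0 <= V t <= 1) ->
  0 <= s -> 0 < w -> s + w <= 1 -> 0 < lam ->
  p [set t | s < V t <= s + w /\ place rev l lam ((V t - s) / w) <= x] =
  w * clip ((x - l) / lam).
Proof.
move=> mV pV V01 s0 w0 sw lam0.
have mle x' : measurable [set t | V t <= x'] by exact: measurable_sublevel.
have mlt x' : measurable [set t | V t < x'].
  rewrite (_ : [set t | _] = ~` [set t | x' <= V t]).
    apply: measurableC; rewrite (_ : [set t | _] = [set t | - V t <= - x']).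
      by apply: measurable_sublevel; exact: measurable_funN.
    by apply/seteqP; split => t /=; rewrite lerN2.
  by apply/seteqP; split => t /=; rewrite ltNge => /negP.
have plt x' : 0 <= x' <= 1 -> p [set t | V t < x'] = x'.
  move=> /andP[x0 x1]; apply/eqP; rewrite eq_le; apply/andP; split.
    rewrite -[leRHS]pV ?x0 //; apply: pr_le => // t /=; exact: ltW.
  apply/ler_addgt0Pr => e e0.
  have [h|h] := leP e x'; last by rewrite (le_trans (ltW h)) // lerDr pr_ge0.
  rewrite -lerBlDr -[leLHS]pV; last by apply/andP; split; lra.
  by apply: pr_le => // t /= h'; lra.
set z := (x - l) / lam.
have plE y : (place rev l lam y <= x) = ((if rev then 1 - y else y) <= z).
  by rewrite /place -lerBrDl mulrC -ler_pdivlMr.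
have [z0|z0] := ltP z 0.
  rewrite clip_le0 ?ltW // mulr0 (_ : [set _ | _] = set0) ?pr0 //.
  apply/seteqP; split => // t /= [/andP[h1 h2]]; rewrite plE leNgt => /negP; apply.
  apply: lt_le_trans z0 _; case: rev {plE}.
    by rewrite subr_ge0 ler_pdivrMr // mul1r lerBlDl.
  by rewrite divr_ge0 ?ltW // subr_gt0.
have [z1|z1] := leP 1 z.
  rewrite clip_ge1 // mulr1.
  rewrite (_ : [set _ | _] = [set t | V t <= s + w] `\` [set t | V t <= s]).
    rewrite prD //; first by rewrite !pV; lra.
    by move=> t /= h; apply: le_trans h _; rewrite lerDl ltW.
  apply/seteqP; split => t /=.
    by move=> [/andP[h1 h2] _]; split => //; apply/negP; rewrite -ltNge.
  move=> [h1 /negP]; rewrite -ltNge => h2; rewrite h2 h1; split => //.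
  rewrite plE; apply: le_trans z1; case: rev {plE}.
    by rewrite gerBl divr_ge0 ?ltW // subr_gt0.
  by rewrite ler_pdivrMr // mul1r lerBlDl.
rewrite clip_id ?z0 ?ltW //.
have wz : 0 <= w * z by rewrite mulr_ge0 // ltW.
have wz1 : w * z <= w by rewrite ler_piMr // ltW.
case: rev plE => plE.
  rewrite (_ : [set _ | _] = [set t | V t <= s + w] `\` [set t | V t < s + w * (1 - z)]).
    rewrite prD //.
      by rewrite pV ?plt; lra.
    by move=> t /= h; apply: le_trans (ltW h) _; lra.
  apply/seteqP; split => t /=.
    move=> [/andP[h1 h2]]; rewrite plE => h3; split => //; apply/negP; rewrite -leNgt.
    have : 1 - z <= (V t - s) / w by lra.
    by rewrite ler_pdivlMr // => h; lra.
  move=> [h1 /negP]; rewrite -leNgt => h2; rewrite h1 andbT plE; split.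
    apply: lt_le_trans h2; rewrite ltrDl mulr_gt0 //; lra.
  have : 1 - z <= (V t - s) / w by rewrite ler_pdivlMr //; lra.
  lra.
rewrite (_ : [set _ | _] = [set t | V t <= s + w * z] `\` [set t | V t <= s]).
  rewrite prD //; first by rewrite !pV; lra.
  by move=> t /= h; lra.
apply/seteqP; split => t /=.
  move=> [/andP[h1 h2]]; rewrite plE ler_pdivrMr // => h3; split; first lra.
  by apply/negP; rewrite -ltNge.
move=> [h1 /negP]; rewrite -ltNge => h2; rewrite plE h2 ler_pdivrMr //; split; lra.
Qed.

(** Cells of weight w j, in which coordinate i is uniform on the interval
    [l j i, l j i + lam j i] and all coordinates are driven by the same y, glue to
    uniform variables as soon as the distribution functions add up. The piece o
    is the one that the event B avoids; the variables vanish on the null set that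
    the pieces leave uncovered. *)
Lemma piecewise_uniform (I J : finType) (w : J -> R) (l lam : J -> I -> R)
    (rev : J -> I -> bool) (o : J) :
  (forall j, 0 <= w j) -> \sum_j w j = 1 ->
  (forall j i, 0 < w j -> [/\ 0 <= l j i, 0 < lam j i & l j i + lam j i <= 1]) ->
  (forall i x, 0 <= x <= 1 -> \sum_j w j * clip ((x - l j i) / lam j i) = x) ->
  exists U : I -> {RV P >-> R}, (forall i, uniform01 (U i)) /\
  exists B, [/\ measurable B, p B = 1 - w o
    & forall t, B t -> (forall i, U i t = 0) \/
       exists j y, [/\ j != o, 0 < w j, 0 <= y <= 1 &
         forall i, U i t = place (rev j i) (l j i) (lam j i) y]].
Proof.
move=> w0 w1 cell cover.
have [V [mV V01 pV]] := uniform_exists P_atomless.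
have [s [s0 sw sdis scov]] := interval_pieces w0 w1.
pose A j := [set t | s j < V t <= s j + w j].
pose u j i t := place (rev j i) (l j i) (lam j i) ((V t - s j) / w j).
have mle x' : measurable [set t | V t <= x'] by exact: measurable_sublevel.
have AE j : A j = [set t | V t <= s j + w j] `\` [set t | V t <= s j].
  apply/seteqP; split => t; rewrite /A /=.
    by move=> /andP[h1 h2]; split => //; apply/negP; rewrite -ltNge.
  by move=> [h1 /negP]; rewrite -ltNge => ->; rewrite h1.
have mA j : measurable (A j) by rewrite AE; exact: measurableD.
have pA j : p (A j) = w j.
  rewrite AE prD //; last by move=> t /= h; apply: le_trans h _; rewrite lerDl.
  have := sw j; have := s0 j; have := w0 j => h1 h2 h3.
  by rewrite !pV; lra.
have wA j t : A j t -> 0 < w j.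
  by rewrite /A /= => /andP[h1 h2]; move: (lt_le_trans h1 h2); rewrite ltrDl.
have y01 j t : A j t -> 0 <= (V t - s j) / w j <= 1.
  move=> Aj; have wj := wA _ _ Aj; move: Aj => /andP[h1 h2].
  apply/andP; split; first by rewrite divr_ge0 // ltW // subr_gt0.
  by rewrite ler_pdivrMr // mul1r lerBlDl.
have mu_ j i : measurable_fun setT (u j i).
  rewrite /u /place; apply: measurable_funD; first exact: measurable_cst.
  apply: measurable_funM; first exact: measurable_cst.
  have my : measurable_fun setT (fun t => (V t - s j) / w j).
    by apply: measurable_funM; [apply: measurable_funB|]; rewrite //; exact: measurable_cst.
  by case: (rev j i) => //; apply: measurable_funB => //; exact: measurable_cst.
pose U' i t := \sum_j (\1_(A j) t : R) * u j i t.
have mU i : measurable_fun setT (U' i).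
  apply: measurable_sum => j; apply: measurable_funM; last exact: mu_.
  by apply: measurable_indic; exact: mA.
have U'A i j t : A j t -> U' i t = u j i t.
  move=> Aj; rewrite /U' (bigD1 j) //= indicE mem_set // mul1r big1 ?addr0 // => k kj.
  rewrite indicE memNset ?mul0r // => Ak.
  by move: kj; rewrite (sdis _ _ _ Ak Aj) eqxx.
have U'0 i t : V t <= 0 -> U' i t = 0.
  move=> Vt; rewrite /U' big1 // => k _.
  rewrite indicE memNset ?mul0r // => /andP[h1 _].
  by have := s0 k; rewrite leNgt (lt_le_trans h1).
have Acov t : V t <= 0 \/ exists j, A j t.
  have [h|h] := leP (V t) 0; [by left|right].
  by have [|j hj] := scov (V t); [have := V01 t => /andP[_ ->]; rewrite h|exists j].
have uA01 i j t : A j t -> 0 <= u j i t <= 1.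
  move=> Aj; have [l0 lam0 ll] := cell j i (wA _ _ Aj).
  have /andP[y0 y1] := y01 _ _ Aj.
  rewrite /u /place; set y := if _ then _ else _.
  have [hy hy'] : 0 <= y /\ y <= 1 by rewrite /y; case: (rev j i); split; lra.
  apply/andP; split; first by rewrite addr_ge0 // mulr_ge0 // ltW.
  by apply: le_trans ll; rewrite lerD2l ler_piMr // ltW.
have U01 i t : U' i t \in `[0, 1].
  rewrite in_itv /=; have [h|[j Aj]] := Acov t; first by rewrite U'0 // lexx ler01.
  by rewrite (U'A i j t Aj); exact: uA01.
pose U i : {RV P >-> R} := mfun_Sub (mem_set (mU i)).
exists U; split.
  move=> i; apply: uniform01_of_cdf; first by move=> t; exact: U01.
  move=> x x01; rewrite -[RHS](cover i x x01).
  pose B j := [set t | A j t /\ u j i t <= x].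
  have muB j : measurable [set t | u j i t <= x].
    by apply: measurable_sublevel; exact: mu_.
  have mB j : measurable (B j) by exact: (measurableI _ _ (mA j) (muB j)).
  have dB j j' : j != j' -> B j `&` B j' = set0.
    move=> jj'; apply/seteqP; split => // t [[Aj _] [Aj' _]].
    by move: jj'; rewrite (sdis _ _ _ Aj Aj') eqxx.
  have -> : [set t | U i t <= x] =
      \big[setU/set0]_(j <- index_enum J) B j `|` [set t | V t <= 0].
    rewrite -bigcup_seq; apply/seteqP; split => t /=.
      move=> h; have [h'|[j Aj]] := Acov t; [by right|left].
      exists j; first by rewrite /= mem_index_enum.
      by split => //; rewrite -(U'A i j t Aj).
    move=> [[j _ [Aj h]]|h]; first by rewrite (U'A i j t Aj).
    by rewrite U'0 //; case/andP: x01.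
  have mbig : measurable (\big[setU/set0]_(j <- index_enum J) B j).
    exact: bigsetU_measurable.
  rewrite prU //; last first.
    rewrite -bigcup_seq; apply/seteqP; split => // t [[j _ [/andP[h1 _] _]] h2].
    by have := s0 j; rewrite leNgt (lt_le_trans h1).
  rewrite pV ?lexx ?ler01 // addr0 pr_bigU ?index_enum_uniq //.
  apply: eq_bigr => j _.
  have [wj|wj] := ltP 0 (w j).
    have [l0 lam0 ll] := cell j i wj.
    exact: piece_cdf.
  have wj0 : w j = 0 by apply/eqP; rewrite eq_le wj w0.
  rewrite wj0 mul0r (_ : B j = set0) ?pr0 //.
  by apply/seteqP; split => // t [/wA]; rewrite wj0 ltxx.
exists (~` A o); split.
- exact: measurableC.
- rewrite -setTD prD //; first by rewrite prT pA.
- move=> t nA; have [h|[j Aj]] := Acov t; first by left => i; exact: U'0.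
  right; exists j, ((V t - s j) / w j); split.
  + by apply/eqP => jo; apply: nA; rewrite -jo.
  + exact: wA Aj.
  + exact: y01.
  + by move=> i; exact: U'A.
Qed.

End Assembly.

(** * The constant c and the coefficient aG *)

Section Root.
Variables (R : realType) (n : R).
Hypothesis n2 : 2 <= n.

Let m := n - 1.
Let p := (n * m)^-1.

(** The difference of the two sides of the equation, with the logarithm split so
    that differentiation is easy; see [cK_gapE]. *)
Definition cK_gap (x : R) : R := ln (1 - m * x) - ln x + (n ^+ 2 * x - n).

Let m1 : 1 <= m.
Proof.
by move: n2; rewrite /m; lra. Qed.
Let m0 : 0 < m. Proof. exact: lt_le_trans m1. Qed.
Let n0 : 0 < n. Proof. by move: n2; lra. Qed.
Let nm0 : 0 < n * m. Proof. exact: mulr_gt0. Qed.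
Let p0 : 0 < p. Proof. by rewrite invr_gt0. Qed.
Let pE : p * (n * m) = 1. Proof. by rewrite mulVf // gt_eqF. Qed.
Let pn : p <= n^-1.
Proof. by rewrite lef_pV2 ?posrE // ler_peMr // ltW. Qed.
Let nV : n * n^-1 = 1. Proof. by rewrite mulfV // gt_eqF. Qed.

Let dom x : x <= n^-1 -> 0 < 1 - m * x.
Proof.
move=> xn; have : m * x <= m * n^-1 by rewrite ler_pM2l.
have : m * n^-1 = 1 - n^-1 by rewrite /m mulrBl nV mul1r.
have : 0 < n^-1 by rewrite invr_gt0.
lra.
Qed.

Lemma cK_gapE x : 0 < x <= n^-1 -> cK_gap x = ln (x^-1 - (n - 1)) - (n - n ^+ 2 * x).
Proof.
move=> /andP[x0 xn]; rewrite /cK_gap; have d := dom xn.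
have -> : x^-1 - (n - 1) = (1 - m * x) / x.
  by rewrite mulrBl mul1r mulfK ?gt_eqF.
by rewrite ln_div ?posrE //; ring.
Qed.

Lemma is_derive_cK_gap x : 0 < x <= n^-1 ->
  is_derive x 1 cK_gap (- m / (1 - m * x) - x^-1 + n ^+ 2).
Proof.
move=> /andP[x0 xn]; have d := dom xn.
have d1 : is_derive x 1 (fun x : R => 1 - m * x) (- m).
  apply: is_derive_eq; rewrite /GRing.scale /=; ring.
have d2 : is_derive x 1 (fun x : R => ln (1 - m * x)) (- m / (1 - m * x)).
  have := @is_derive1_comp _ (@ln R) (fun x : R => 1 - m * x) x _ _ (is_derive1_ln d) d1.
  by rewrite mulrC.
have d3 : is_derive x 1 (fun x : R => n ^+ 2 * x - n) (n ^+ 2).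
  apply: is_derive_eq; rewrite /GRing.scale /=; ring.
have d4 := is_derive1_ln x0.
rewrite /cK_gap.
apply: is_deriveD.
Qed.

(** The factor 1 - n m x changes sign at 1/(n m), the other one at 1/n. *)
Lemma cK_gap_derive x : 0 < x < n^-1 ->
  derive1 cK_gap x = (n * x - 1) * (1 - n * m * x) / (x * (1 - m * x)).
Proof.
move=> /andP[x0 xn]; have d := dom (ltW xn).
rewrite derive1E; have [_ ->] := is_derive_cK_gap (introT andP (conj x0 (ltW xn))).
by rewrite /m in d *; field; rewrite !gt_eqF.
Qed.

Let cont a b : 0 < a -> b <= n^-1 -> {within `[a, b], continuous cK_gap}.
Proof.
move=> a0 bn; apply: continuous_in_subspaceT => x.
rewrite inE /= in_itv /= => /andP[ax xb].
apply: differentiable_continuous; apply/derivable1_diffP.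
have [] // := @is_derive_cK_gap x.
by rewrite (lt_le_trans a0 ax) (le_trans xb bn).
Qed.

Lemma cK_gap_decr x y : 0 < x -> x < y -> y <= p -> cK_gap y < cK_gap x.
Proof.
move=> x0 xy yp.
apply: (@ltr0_derive1_lt_cc _ cK_gap x y) => //.
- move=> z; rewrite in_itv /= => /andP[xz zy].
  have [] // := @is_derive_cK_gap z.
  by rewrite (lt_trans x0 xz) (le_trans (ltW zy)) // (le_trans yp).
- move=> z; rewrite in_itv /= => /andP[xz zy].
  have z0 := lt_trans x0 xz.
  have zp : z < p by exact: lt_le_trans yp.
  have zn : z < n^-1 by exact: lt_le_trans pn.
  rewrite cK_gap_derive ?z0 //.
  rewrite pmulr_llt0; last by rewrite invr_gt0 mulr_gt0 // dom // ltW.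
  rewrite nmulr_rlt0.
    have : z * (n * m) < p * (n * m) by rewrite ltr_pM2r.
    by rewrite pE mulrC; lra.
  by rewrite subr_lt0 -nV ltr_pM2l.
- apply: cont => //; exact: le_trans pn.
- by rewrite in_itv /= lexx ltW.
- by rewrite in_itv /= lexx ltW.
Qed.

Lemma cK_gap_incr x y : p <= x -> x < y -> y <= n^-1 -> cK_gap x < cK_gap y.
Proof.
move=> px xy yn; have x0 : 0 < x by exact: lt_le_trans px.
apply: (@gtr0_derive1_lt_cc _ cK_gap x y) => //.
- move=> z; rewrite in_itv /= => /andP[xz zy].
  have [] // := @is_derive_cK_gap z.
  by rewrite (lt_trans x0 xz) (le_trans (ltW zy)).
- move=> z; rewrite in_itv /= => /andP[xz zy].
  have z0 := lt_trans x0 xz.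
  have pz : p < z by exact: le_lt_trans xz.
  have zn : z < n^-1 by exact: lt_le_trans yn.
  rewrite cK_gap_derive ?z0 //.
  rewrite pmulr_lgt0; last by rewrite invr_gt0 mulr_gt0 // dom // ltW.
  rewrite nmulr_lgt0.
    by rewrite subr_lt0 -nV ltr_pM2l.
  have : p * (n * m) < z * (n * m) by rewrite ltr_pM2r.
  by rewrite pE mulrC; lra.
- exact: cont.
- by rewrite in_itv /= lexx ltW.
- by rewrite in_itv /= lexx ltW.
Qed.

Lemma cK_gap_inv : cK_gap n^-1 = 0.
Proof.
rewrite cK_gapE ?invr_gt0 ?n0 //= invrK.
have -> : n - (n - 1) = 1 by ring.
by rewrite ln1 expr2 -mulrA nV mulr1 subrr subr0.
Qed.

Lemma cK_gap_root : 2 < n -> exists2 c, 0 < c < p & cK_gap c = 0.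
Proof.
move=> n2'.
have pn' : p < n^-1.
  by rewrite ltf_pV2 ?posrE // ltr_pMr //; rewrite /m; lra.
have psip : cK_gap p < 0 by rewrite -cK_gap_inv; exact: cK_gap_incr.
(* At this point the logarithm equals n, so the gap is n^2 x0 > 0. *)
pose x0 := (expR n + m)^-1.
have e0 : 0 < expR n := expR_gt0 n.
have x00 : 0 < x0 by rewrite invr_gt0 addr_gt0.
have x0n : x0 < n^-1.
  rewrite ltf_pV2 ?posrE //; last exact: addr_gt0.
  have : 1 < expR n by rewrite expR_gt1.
  by rewrite /m; lra.
have psix0 : 0 < cK_gap x0.
  rewrite cK_gapE; last by rewrite x00 ltW.
  have -> : x0^-1 = expR n + m by rewrite invrK.
  have -> : expR n + m - (n - 1) = expR n by rewrite /m; ring.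
  by rewrite expRK; have : 0 < n ^+ 2 * x0 by [rewrite mulr_gt0 // exprn_gt0]; lra.
have x0p : x0 < p.
  rewrite ltNge le_eqVlt; apply/negP => /orP[/eqP E|px].
    by move: psix0; rewrite -E ltNge ltW.
  have := cK_gap_incr (ltW px) x0n (lexx _).
  by rewrite cK_gap_inv ltNge ltW.
have [|c] := @IVT R cK_gap x0 p 0 (ltW x0p) (cont x00 pn).
  by rewrite ge_min (ltW psip) orbT le_max (ltW psix0).
rewrite in_itv /= => /andP[xc cp] c0; exists c => //.
rewrite (lt_le_trans x00 xc) /= lt_neqAle cp andbT.
by apply/eqP => E; move: psip; rewrite -E c0 ltxx.
Qed.

Lemma cK_gap_root_uniq x y : 0 < x < n^-1 -> 0 < y < n^-1 -> cK_gap x = 0 -> cK_gap y = 0 -> x = y.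
Proof.
have H z : 0 < z < n^-1 -> cK_gap z = 0 -> z < p.
  move=> /andP[z0 zn] pz; rewrite ltNge; apply/negP => pz'.
  have := cK_gap_incr pz' zn (lexx _).
  by rewrite cK_gap_inv pz ltxx.
move=> hx hy px py; have hx' := H _ hx px; have hy' := H _ hy py.
have [xy|yx|//] := ltgtP x y.
  have := cK_gap_decr (andP hx).1 xy (ltW hy').
  by rewrite px py ltxx.
have := cK_gap_decr (andP hy).1 yx (ltW hx').
by rewrite px py ltxx.
Qed.

End Root.

(** The bound by the turning point 1/(K (K - 1)) is what all later estimates use.
    It is strict for K > 2, while for K = 2 the turning point is the root. *)
Definition cK_spec (R : realType) (K : nat) (c : R) : Prop :=
  [/\ 0 < c <= (K%:R * (K%:R - 1))^-1, cK_equation K c,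
      (2 < K)%N -> c < (K%:R * (K%:R - 1))^-1
    & K = 2%N -> c = 2^-1].

Section Constants.
Variables (R : realType) (K : nat).
Hypothesis K2 : (2 <= K)%N.
Let n : R := K%:R.
Let n2 : 2 <= n. Proof. by rewrite /n ler_nat. Qed.
Let p_le : (n * (n - 1))^-1 <= n^-1.
Proof. by rewrite lef_pV2 ?posrE; move: n2 => ?; nra. Qed.

Lemma cK_equationE x : 0 < x <= n^-1 -> cK_equation K x <-> cK_gap n x = 0.
Proof.
move=> hx; rewrite cK_gapE // /cK_equation -/n; split => [->|/eqP]; first by rewrite subrr.
by rewrite subr_eq0 => /eqP.
Qed.

Lemma cK_exists : exists c : R, cK_spec K c.
Proof.
have [K3|] := ltnP 2 K; last first.
  move=> K2'; have E : K = 2%N by lia.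
  exists 2^-1; split => //; rewrite ?E /cK_equation //.
  - have -> : (2 * (2 - 1) : R) = 2 by ring.
    by rewrite invr_gt0 ltr0n lexx.
  - rewrite invrK (_ : 2 - (2 - 1) = 1 :> R) ?ln1; first by lra.
    by ring.
have n3 : 2 < n by rewrite /n (ltr_nat R 2).
have [c /andP[c0 cp] pc] := cK_gap_root n2 n3.
exists c; split => //.
- by rewrite c0 ltW.
- have h : 0 < c <= n^-1 by rewrite c0 (le_trans (ltW cp)).
  by apply/(cK_equationE h).
- by move=> E; move: K3; rewrite E.
Qed.

Lemma cK_uniq c : cK_spec K c ->
  ((2 < K)%N -> unique (fun x : R => 0 < x < K%:R^-1 /\ cK_equation K x) c) /\
  (K = 2%N -> unique (fun x : R => 0 < x <= 2^-1 /\ cK_equation 2 x) c).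
Proof.
move=> [/andP[c0 cp] ce c3 c2]; split.
  move=> K3; have cn : c < n^-1 by exact: lt_le_trans (c3 K3) p_le.
  split; first by rewrite c0.
  move=> x [/andP[x0 xn] xe].
  apply: (cK_gap_root_uniq n2); rewrite ?c0 ?x0 //.
  - have h : 0 < c <= n^-1 by rewrite c0 (ltW cn).
    by apply/(cK_equationE h).
  - have h : 0 < x <= n^-1 by rewrite x0 (ltW xn).
    by apply/(cK_equationE h).
move=> E; rewrite (c2 E) in ce cp c0 *; split; first by rewrite c0 lexx; move: ce; rewrite E.
move=> x [/andP[x0 xn] xe].
have nE : n = 2 by rewrite /n E.
have xe' : cK_gap n x = 0.
  have h : 0 < x <= n^-1 by rewrite x0 nE.
  by apply/(cK_equationE h); rewrite E.
move: xn; rewrite le_eqVlt => /orP[/eqP //|xn].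
have pE : (n * (n - 1))^-1 = 2^-1 by rewrite nE; congr (_^-1); ring.
have := cK_gap_decr n2 x0 xn; rewrite pE lexx xe' => /(_ isT).
by rewrite -nE cK_gap_inv // ltxx.
Qed.

Variable c : R.
Hypothesis good : cK_spec K c.
Let A : R := 1 - (n - 1) * c.

Let c0 : 0 < c. Proof. by case: good => /andP[]. Qed.
Let cp : n * (n - 1) * c <= 1.
Proof.
case: good => /andP[_ cp] _ _ _.
have p0 : 0 < n * (n - 1) by move: n2 => ?; nra.
by move: cp; rewrite -/n -(ler_pM2l p0) mulfV // gt_eqF.
Qed.

Lemma cK_A_gt0 : 0 < 1 - (K%:R - 1) * c.
Proof. by rewrite -/n; move: n2 c0 cp => ? ? ?; nra. Qed.
Let A0 : 0 < A := cK_A_gt0.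

Lemma cK_ratio : expR (n - n ^+ 2 * c) = A / c.
Proof.
case: good => _ <- _ _; rewrite lnK; first by rewrite mulrBl mul1r mulfK ?gt_eqF.
rewrite posrE (_ : _ - _ = A / c) ?divr_gt0 //.
by rewrite mulrBl mul1r mulfK ?gt_eqF.
Qed.

Lemma aGE : aG K c = expR (1 - n * c) / A.
Proof.
rewrite /aG -/n.
have -> : - ((n - 1) * (1 - n * c)) = (1 - n * c) - (n - n ^+ 2 * c) by ring.
rewrite expRB cK_ratio; field.
by rewrite !gt_eqF.
Qed.

Lemma aG_gt0 : 0 < aG K c.
Proof. by rewrite aGE divr_gt0 // expR_gt0. Qed.

(** exp (- n c) <= 1 / (1 + n c) <= A, the second step being n (n - 1) c <= 1. *)
Lemma aG_le_e : aG K c <= expR 1.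
Proof.
rewrite aGE expRB ler_pdivrMr // ler_pM2l ?expR_gt0 //.
have h1 := expR_ge1Dx (n * c).
have q0 : 0 < 1 + n * c by move: n2 c0 => ? ?; nra.
apply: le_trans (_ : (1 + n * c)^-1 <= _).
  by rewrite lef_pV2 ?posrE ?expR_gt0.
rewrite -div1r ler_pdivrMr // /A; move: n2 c0 cp => ? ? ?; nra.
Qed.

Lemma aG_lower : expR (1 - (n - 1)^-1) <= aG K c.
Proof.
rewrite aGE ler_pdivlMr //.
apply: le_trans (_ : expR (1 - (n - 1)^-1) <= _).
  rewrite ler_piMr ?expR_ge0 // /A; move: n2 c0 => ? ?; nra.
rewrite ler_expR lerD2l lerN2 -div1r ler_pdivlMr; move: n2 cp => ? ?; nra.
Qed.

Lemma aG_pow : aG K c ^+ K * (c * A ^+ K.-1) = 1.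
Proof.
rewrite /aG -/n exprMn -expRM_natl -/n.
have -> : n * - ((n - 1) * (1 - n * c)) = - (K.-1%:R * (n - n ^+ 2 * c)).
  have -> : K.-1%:R = n - 1 by rewrite /n -subn1 natrB // (leq_trans _ K2).
  by ring.
rewrite expRN expRM_natl cK_ratio.
have -> : c ^-1 ^+ K = c^-1 * c ^- K.-1.
  by rewrite exprVn -exprVn -{1}(prednK (leq_trans _ K2)) // exprS exprVn.
rewrite expr_div_n; field.
by rewrite !expf_neq0 gt_eqF.
Qed.

End Constants.

Lemma aG_cvg (R : realType) (c : nat -> R) :
  (forall K, (2 <= K)%N -> cK_spec K (c K)) -> aG K (c K) @[K --> \oo] --> expR 1.
Proof.
move=> good.
apply: (@squeeze_cvgr _ _ _ _ (fun K : nat => expR (1 - (K%:R - 1)^-1 : R)) (fun=> expR 1)).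
- near=> K; have K2 : (2 <= K)%N by near: K; exact: nbhs_infty_ge.
  by rewrite aG_lower ?aG_le_e //; exact: good.
- have h : (fun K : nat => 1 - (K%:R - 1)^-1 : R) @ \oo --> (1 : R).
    apply/cvgrPdist_lt => e e0; near=> K.
    have h : e^-1 < K%:R - 1 :> R.
      by rewrite ltrBrDr; near: K; exact: nbhs_infty_gtr.
    have h0 : 0 < K%:R - 1 :> R by apply: lt_trans h; rewrite invr_gt0.
    rewrite opprB addrCA subrr addr0 gtr0_norm ?invr_gt0 //.
    by rewrite -[e]invrK ltf_pV2 ?posrE ?invr_gt0.
  by apply: (cvg_comp _ _ h); exact: continuous_expR.
- exact: cvg_cst.
Unshelve. all: by end_near. Qed.

(** * Validity *)

Lemma geometric_sum (R : comPzRingType) (q : R) N :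
  (1 - q) * \sum_(k < N) q ^+ k = 1 - q ^+ N.
Proof. by rewrite -[1 - q]opprB -[1 - _]opprB subrX1 mulNr. Qed.

Section Count.
Variables (R : realFieldType) (q : R).
Hypothesis q01 : 0 < q < 1.

(** The powers of q decrease, so the k with v <= q^k form an initial segment. *)
Lemma geometric_count (v : R) N :
  let n := (\sum_(k < N) (v <= q ^+ k)%R)%N in n = N \/ (n <= N)%N /\ q ^+ n < v.
Proof.
have /andP[q0 q1] := q01.
elim: N => [|N IH] /=; first by left; rewrite big_ord0.
rewrite big_ord_recr /=; move: IH => /=; set n := (\sum_(k < N) _)%N.
move=> [->|[nN qv]].
  by have [h|h] := leP v (q ^+ N); [left; rewrite addn1|right; rewrite addn0; split].
right; have -> : (v <= q ^+ N) = false.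
  apply/negbTE; rewrite -ltNge; apply: le_lt_trans qv.
  by rewrite ler_wiXn2l // ltW.
by rewrite addn0; split => //; exact: leqW.
Qed.

(** If every count n_i is below N, then v_i > q^(n_i) for all i, so the product
    exceeds q to the sum of the counts. *)
Lemma prod_le_count (I : finType) (v : I -> R) N : (0 < #|I|)%N ->
  \prod_i v i <= q ^+ N ->
  (N <= \sum_i \sum_(k < N) (v i <= q ^+ k)%R)%N.
Proof.
have /andP[q0 q1] := q01.
move=> I0 pv; pose n i := (\sum_(k < N) (v i <= q ^+ k)%R)%N.
have [[i ni]|H] := pselect (exists i, n i = N).
  by rewrite (bigD1 i) //= -/(n i) ni leq_addr.
have h i : q ^+ n i < v i.
  by have [ni|[_ //]] := geometric_count (v i) N; case: H; exists i.
rewrite leqNgt; apply/negP => hN.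
have : q ^+ N < \prod_i v i.
  apply: lt_le_trans (_ : q ^+ (\sum_i n i)%N <= _).
    by rewrite ltr_iXn2l.
  rewrite expr_sum; apply: ler_prod => i _.
  by rewrite exprn_ge0 ?ltW.
by rewrite ltNge pv.
Qed.

End Count.

Section Validity.
Context (d : measure_display) (T : measurableType d) (R : realType) (P : probability T R).
Local Notation p := (pr P).

Lemma measurable_prod_le (I : finType) (U : I -> {RV P >-> R}) (x : R) :
  measurable [set t | \prod_i U i t <= x].
Proof.
apply: (@measurable_sublevel _ _ _ (fun t => \prod_i U i t)).
by apply: measurable_prod => i _; exact: measurable_funP.
Qed.

Lemma markov_count (J : finType) (B : J -> set T) (E : set T) (N : nat) :
  measurable E -> (forall j, measurable (B j)) ->
  (forall t, E t -> (N <= \sum_j `[< B j t >])%N) ->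
  N%:R * p E <= \sum_j p (B j).
Proof.
move=> mE mB H; rewrite -lee_fin EFinM -prE // -integral_cst //.
apply: (@le_trans _ _ (\int[P]_(x in E) (\sum_j (\1_(B j) x)%:E))%E).
  apply: ge0_le_integral => //.
  - by move=> t _; rewrite lee_fin.
  - apply: emeasurable_sum => j; apply/measurable_EFinP.
    exact: measurable_indic.
  - move=> t Et; rewrite sumEFin lee_fin.
    apply: le_trans (_ : (\sum_j `[< B j t >])%:R <= _); first by rewrite ler_nat H.
    rewrite natr_sum; apply: ler_sum => j _; rewrite indicE.
    by case: asboolP => h; [rewrite mem_set|rewrite memNset].
rewrite ge0_integral_sum //; last first.
  by move=> j; apply/measurable_EFinP; exact: measurable_indic.
rewrite -sumEFin; apply: lee_sum => j _.
rewrite integral_indic // -prE //.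
by apply: le_measure; rewrite ?inE //; exact: measurableI.
Qed.

Variables (K : nat).
Hypothesis K2 : (2 <= K)%N.

Lemma geometric_mean_le (a e : R) (q : K.-tuple R) : 0 < a -> 0 <= e ->
  (forall i, 0 <= tnth q i) ->
  (a * geometric_mean q <= e) = (a ^+ K * (\prod_(k < K) tnth q k) <= e ^+ K).
Proof.
move=> a0 e0 q0; rewrite /geometric_mean.
have K0 : (0 < K)%N by exact: leq_trans K2.
have pr0' : 0 <= \prod_(k < K) tnth q k by apply: prodr_ge0 => i _.
rewrite -(ler_pXn2r K0) ?nnegrE ?mulr_ge0 ?powR_ge0 ?(ltW a0) //.
rewrite exprMn -[(_ `^ _) ^+ K]powR_mulrn ?powR_ge0 //.
by rewrite -powRrM mulVf ?powRr1 // pnatr_eq0 -lt0n.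
Qed.

Variable c : R.
Hypothesis good : cK_spec K c.
Let n : R := K%:R.
Let A : R := 1 - (n - 1) * c.
Let A0 : 0 < A. Proof. exact: cK_A_gt0 good. Qed.
Let c0 : 0 < c. Proof. by case: good => /andP[]. Qed.
Let n2 : 2 <= n. Proof. by rewrite /n ler_nat. Qed.

Lemma aG_mean_le (e : R) (q : K.-tuple R) : 0 <= e -> (forall i, 0 <= tnth q i) ->
  (aG K c * geometric_mean q <= e) =
  (\prod_(k < K) tnth q k <= e ^+ K * (c * A ^+ K.-1)).
Proof.
move=> e0 q0; rewrite geometric_mean_le // ?aG_gt0 //.
have h : 0 < c * A ^+ K.-1 by rewrite mulr_gt0 // exprn_gt0.
have := aG_pow K2 good; rewrite -/n -/A => E.
by rewrite -(ler_pM2r h) mulrAC E mul1r.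
Qed.

Variable U : 'I_K -> {RV P >-> R}.
Hypothesis Uu : forall i, uniform01 (U i).
Variable e : R.
Hypothesis e01 : 0 < e < 1.

Let e0 : 0 < e. Proof. by case/andP: e01. Qed.
Let E : set T := [set t | \prod_(k < K) U k t <= e ^+ K * (c * A ^+ K.-1)].

Let mE : measurable E. Proof. exact: measurable_prod_le. Qed.

Let mU i x : measurable [set t | U i t <= x].
Proof. exact: measurable_sublevel. Qed.

Let pU i x : 0 <= x -> p [set t | U i t <= x] <= x.
Proof.
by move=> x0; rewrite uniform01_le // /clip ge_max x0 /= ge_min lexx.
Qed.

(* For K = 2 one has A = c = 1/2: the product bound forces some U i <= e c. *)
Let valid2 : K = 2%N -> p E <= e.
Proof.
move=> K2'; case: good => _ _ _ /(_ K2') c2.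
have nE : n = 2 by rewrite /n K2'.
have AE : A = c by rewrite /A nE c2; lra.
rewrite -[p E]mul1r.
apply: le_trans (@markov_count 'I_K (fun i => [set t | U i t <= e * c]) E 1 mE _ _) _.
- by move=> i; exact: mU.
- move=> t Et; rewrite lt0n sum_nat_eq0; apply/negP => /forallP /= H.
  have : (e * c) ^+ K < \prod_(k < K) U k t.
    rewrite -[X in _ ^+ X]card_ord -prodr_const; apply: ltr_prod.
      by apply/hasP; exists (Ordinal (ltnW K2)) => //; exact: mem_index_enum.
    move=> i _; rewrite (ltW (mulr_gt0 e0 c0)) /=.
    by have := H i; rewrite eqb0 => /asboolP /= /negP; rewrite -ltNge.
  rewrite ltNge; apply/negP; rewrite negbK.
  by move: Et; rewrite /E /= AE -exprS prednK ?exprMn // (leq_trans _ K2).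
- apply: le_trans (_ : \sum_(i < K) (e * c) <= _).
    by apply: ler_sum => i _; apply: pU; rewrite mulr_ge0 // ltW.
  by rewrite sumr_const card_ord -mulr_natl -/n nE c2; lra.
Qed.

(* The geometric sum G of the thresholds satisfies (1 - q) G = 1 - c / A, and
   1 - q is D / N up to a factor 1 + D / N. *)
Let valid3 : (2 < K)%N -> p E <= e.
Proof.
move=> K3; have nc : n * c < 1.
  case: good => _ _ /(_ K3) + _; rewrite -/n.
  have h : 0 < n * (n - 1) by move: n2 => ?; nra.
  rewrite -(ltr_pM2l h) mulfV ?gt_eqF // => h'.
  by move: n2 c0 => ? ?; nra.
pose D := n - n ^+ 2 * c.
have D0 : 0 < D by rewrite /D; move: n2 => ?; nra.
have eD : expR D = A / c := cK_ratio K2 good.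
have key N : (0 < N)%N -> p E <= e * (1 + D / N%:R).
  move=> N0; pose q := expR (- (D / N%:R)).
  have DN : 0 < D / N%:R by rewrite divr_gt0 // ltr0n.
  have q0 : 0 < q := expR_gt0 _.
  have q1 : q < 1 by rewrite expR_lt1 oppr_lt0.
  have qN : q ^+ N = c / A.
    rewrite -expRM_natl mulrN mulrCA mulfV ?mulr1 ?pnatr_eq0 -?lt0n //.
    by rewrite expRN eD invf_div.
  have eA : 0 < e * A by rewrite mulr_gt0.
  pose B (j : 'I_K * 'I_N) := [set t | U j.1 t <= e * A * q ^+ j.2].
  have H : N%:R * p E <= \sum_(j : 'I_K * 'I_N) p (B j).
    apply: markov_count => //; first by move=> j; exact: mU.
    move=> t Et.
    have := @prod_le_count _ q (introT andP (conj q0 q1)) 'I_K (fun i => U i t / (e * A)) N.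
    rewrite card_ord => /(_ (leq_trans _ K2)) -/(_ isT) H.
    apply: leq_trans (H _) _.
      rewrite big_split /= prodr_const card_ord qN exprVn ler_pdivrMr ?exprn_gt0 //.
      move: Et; rewrite /E /= => /le_trans; apply.
      have AK : A ^+ K = A * A ^+ K.-1 by rewrite -exprS prednK // (leq_trans _ K2).
      rewrite exprMn AK le_eqVlt; apply/orP; left; apply/eqP; field.
      by rewrite gt_eqF.
    rewrite pair_big /=; apply: leq_sum => -[i k] _ /=.
    rewrite /B /= ler_pdivrMr // mulrC.
    by case: (boolP (_ <= _)) => // h; case: asboolP.
  set G := \sum_(k < N) q ^+ k.
  have G0 : 0 <= G by apply: sumr_ge0 => k _; rewrite exprn_ge0 // ltW.
  have HG : N%:R * p E <= n * (e * A * G).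
    apply: le_trans H _.
    rewrite -(pair_big xpredT xpredT (fun i k => p (B (i, k)))) /=.
    rewrite /n -[X in _ <= X%:R * _]card_ord mulr_natl -sumr_const.
    apply: ler_sum => i _; rewrite /G mulr_sumr; apply: ler_sum => k _.
    by apply: pU; rewrite mulr_ge0 ?exprn_ge0 // ltW.
  have qG : (1 - q) * G = 1 - c / A.
    by rewrite geometric_sum qN.
  have qd : q * (1 + D / N%:R) <= 1.
    apply: le_trans (_ : q * expR (D / N%:R) <= _); last by rewrite mulrC expRxMexpNx_1.
    by rewrite ler_pM2l // expR_ge1Dx.
  have AD : n * (A - c) = D by rewrite /A /D; ring.
  have AG : n * A * ((1 - q) * G) = D by rewrite qG -AD; field; rewrite gt_eqF.
  set dl := D / N%:R in DN qd *.
  have Ndl : N%:R * dl = D by rewrite /dl mulrCA mulfV ?mulr1 // pnatr_eq0 -lt0n.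
  rewrite -(ler_pM2l D0) -{1}Ndl.
  have -> : N%:R * dl * p E = dl * (N%:R * p E) by ring.
  apply: le_trans (_ : dl * (n * (e * A * G)) <= _); first by rewrite ler_pM2l.
  rewrite -[D in leRHS]AG.
  have -> : n * A * ((1 - q) * G) * (e * (1 + dl)) = n * (e * A * G) * ((1 - q) * (1 + dl)).
    by ring.
  rewrite [leLHS]mulrC ler_wpM2l //; last by lra.
  by rewrite mulr_ge0 ?(le_trans _ n2) // mulr_ge0 // ltW.
apply/ler_addgt0Pr => x x0.
have h := archi_boundP (ltW (divr_gt0 (mulr_gt0 e0 D0) x0)).
set N := Num.bound _ in h.
have N0 : (0 < N)%N.
  by rewrite -(ltr_nat R); apply: lt_trans h; rewrite divr_gt0 // mulr_gt0.
apply: le_trans (key N N0) _.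
rewrite mulrDr mulr1 lerD2l mulrA ler_pdivrMr ?ltr0n //.
by move: h; rewrite ltr_pdivrMr // [x * _]mulrC => /ltW.
Qed.

Lemma prod_small_bound : p E <= e.
Proof.
by have [K3|K3] := ltnP 2 K; [exact: valid3|apply: valid2; lia].
Qed.

End Validity.

(** * The extremal dependence structure *)

Lemma geometric_mean_sum (R : comPzRingType) (q : R) N :
  (1 - q) ^+ 2 * \sum_(k < N.+1) q ^+ k * k%:R =
  q - q ^+ N.+1 - (1 - q) * N%:R * q ^+ N.+1.
Proof.
elim: N => [|N IH]; first by rewrite big_ord_recr big_ord0 /=; ring.
by rewrite big_ord_recr /= mulrDr IH !exprS -natr1; ring.
Qed.

(** Weights on tuples of cells, cell k being [A q^(k+1), A q^k] for k <= N, that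
    make each coordinate uniform on [c', A]; along a tuple of weight w t > 0 the
    product of the coordinates is at most A^K q^(N - 2 K). *)
Definition bulk_coupling (R : realType) (K : nat) (c' q : R) (N : nat)
    (w : {ffun 'I_K -> 'I_N.+1} -> R) : Prop :=
  let A := 1 - (K%:R - 1) * c' in
  [/\ A * q ^+ N.+1 = c', forall t, 0 <= w t,
      forall t, 0 < w t -> (N <= \sum_(i < K) t i + 2 * K)%N
    & forall k, (k <= N)%N ->
        \sum_t w t * (\sum_(i < K) (t i == k :> nat))%:R = A * q ^+ k * (1 - q)].

(** For c' slightly above c, the gap of the equation is negative at c', which
    means that the truncated exponential law between c' and A has mean strictly
    above a fraction 1/K of its range. This surplus survives discretization with
    a fine grid, and [decreasing_mix] applies. For K = 2 the interval [c', A] is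
    a point and no weight is needed. *)
Lemma bulk_coupling_exists (R : realType) (K : nat) (c rho : R) : (2 <= K)%N ->
  cK_spec K c -> 1 < rho ->
  exists c' q N (w : {ffun 'I_K -> 'I_N.+1} -> R),
    [/\ c <= c' <= rho * c, K%:R * (K%:R - 1) * c' <= 1, 0 < q <= 1,
        1 <= rho * q ^+ (2 * K).+1 & bulk_coupling c' q w].
Proof.
move=> K2 good rho1; set n : R := K%:R.
have n2 : 2 <= n by rewrite /n ler_nat.
have c0 : 0 < c by case: good => /andP[].
have [K3|K3] := ltnP 2 K; last first.
  have KE : K = 2%N by lia.
  have cE : c = 2^-1 by case: good => _ _ _; apply.
  have nE : n = 2 by rewrite /n KE.
  exists c, 1, 0%N, (fun=> 0); split.
  - by rewrite lexx /= ler_peMl // ltW.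
  - by rewrite nE cE; lra.
  - by rewrite ltr01 lexx.
  - by rewrite expr1n mulr1 ltW.
  - split => //; rewrite -/n ?nE ?cE.
    + by rewrite expr1; lra.
    + by move=> k _; rewrite subrr mulr0 big1 // => t _; rewrite mul0r.
pose p := (n * (n - 1))^-1.
have nn0 : 0 < n * (n - 1) by move: n2 => ?; nra.
have pE : n * (n - 1) * p = 1 by rewrite mulfV // gt_eqF.
have cp : c < p by case: good => _ _ /(_ K3).
pose c' := Num.min (rho * c) p.
have rc : c < rho * c by rewrite ltr_pMl.
have cc' : c < c' by rewrite lt_min rc cp.
have c'p : c' <= p by rewrite ge_min lexx orbT.
have c'0 : 0 < c' := lt_trans c0 cc'.
have nc' : n * (n - 1) * c' <= 1 by rewrite -[leRHS]pE ler_pM2l.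
have n3 : 2 < n by rewrite /n (ltr_nat R 2).
have nc1 : n * c' < 1 by move: n3 c'0 => ? ?; nra.
have pn : p <= n^-1 by rewrite lef_pV2 ?posrE //; move: n2 => ?; nra.
pose A := 1 - (n - 1) * c'.
have A0 : 0 < A by rewrite /A; move: n2 c'0 => ? ?; nra.
have cA : c' < A by rewrite /A; lra.
have psi0 : cK_gap n c' < 0.
  have cn : 0 < c <= n^-1 by rewrite c0 (le_trans (ltW cp)).
  have <- : cK_gap n c = 0 by apply/(cK_equationE K2 cn); case: good.
  exact: cK_gap_decr.
pose D := ln (A / c').
have eD : expR D = A / c' by rewrite lnK // posrE divr_gt0.
have D0 : 0 < D by rewrite ln_gt0 // ltr_pdivlMr // mul1r.
have Dlt : D < n * (1 - n * c').
  move: psi0; rewrite cK_gapE //; last by rewrite c'0 (le_trans c'p).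
  have -> : c'^-1 - (n - 1) = A / c' by rewrite /A; field; rewrite gt_eqF.
  by rewrite -/D; lra.
(* The surplus of the mean; N must be at least n / dl to use it. *)
pose dl := A^-1 * (n * (1 - n * c') / D - 1).
have dl0 : 0 < dl.
  by apply: mulr_gt0; [rewrite invr_gt0|rewrite subr_gt0 ltr_pdivlMr // mul1r].
have rho0 : 0 < rho by exact: lt_trans rho1.
have r0 : 0 < 1 - rho^-1 by rewrite subr_gt0 invf_lt1.
pose x1 := n / dl; pose x2 := D * (2 * K).+1%:R / (1 - rho^-1).
have x10 : 0 <= x1 by rewrite divr_ge0 ?ler0n // ltW.
have x20 : 0 <= x2 by rewrite divr_ge0 ?mulr_ge0 ?ler0n // ltW.
have [B1 B1x] : exists B : nat, x1 <= B%:R.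
  by exists (Num.bound x1); apply: ltW; exact: archi_boundP.
have [B2 B2x] : exists B : nat, x2 <= B%:R.
  by exists (Num.bound x2); apply: ltW; exact: archi_boundP.
pose N := (2 * K ^ 2 + B1 + B2)%N.
have Nx1 : x1 <= N%:R.
  apply: le_trans B1x _; rewrite ler_nat /N.
  by apply: leq_trans (leq_addr _ _); exact: leq_addl.
have Nx2 : x2 <= N%:R by apply: le_trans B2x _; rewrite ler_nat leq_addl.
have NK : (2 * K ^ 2 <= N)%N by rewrite /N -addnA leq_addr.
pose h := D / N.+1%:R.
have h0 : 0 < h by rewrite divr_gt0.
pose q := expR (- h).
have q0 : 0 < q := expR_gt0 _.
have q1 : q < 1 by rewrite expR_lt1 oppr_lt0.
have qN : q ^+ N.+1 = c' / A.
  by rewrite -expRM_natl mulrN /h mulrCA mulfV // mulr1 expRN eD invf_div.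
have AQ : A * q ^+ N.+1 = c' by rewrite qN mulrCA mulfV ?mulr1 // gt_eqF.
have q1h : 1 - q <= h by have := expR_ge1Dx (- h); rewrite -/q; lra.
pose g k := if (k <= N)%N then A * q ^+ k * (1 - q) else 0.
have gge0 k : 0 <= g k.
  rewrite /g; case: ifP => // _; apply: mulr_ge0; last by rewrite subr_ge0 ltW.
  by apply: mulr_ge0; [exact: ltW|rewrite exprn_ge0 // ltW].
have gdecr k : g k.+1 <= g k.
  rewrite {1}/g; case: ifP => // kN; rewrite /g (ltnW kN).
  rewrite ler_pM2r ?subr_gt0 // ler_pM2l // exprS ler_piMl ?exprn_ge0 // ltW //.
have gN : g N.+1 = 0 by rewrite /g ltnn.
have gmean : 0 <= \sum_(k < N.+1) g k * (K%:R * k%:R - N%:R).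
  have -> : \sum_(k < N.+1) g k * (K%:R * k%:R - N%:R) =
    A * (n * ((1 - q) * \sum_(k < N.+1) q ^+ k * k%:R) - N%:R * ((1 - q) * \sum_(k < N.+1) q ^+ k)).
    rewrite !mulr_sumr -sumrB mulr_sumr; apply: eq_bigr => k _.
    by rewrite /g -ltnS ltn_ord -/n; ring.
  apply: mulr_ge0; first exact: ltW.
  rewrite geometric_sum.
  have q1' : 0 < 1 - q by rewrite subr_gt0.
  rewrite -(pmulr_rge0 _ q1').
  have -> : (1 - q) * (n * ((1 - q) * \sum_(k < N.+1) q ^+ k * k%:R) - N%:R * (1 - q ^+ N.+1)) =
     n * ((1 - q) ^+ 2 * \sum_(k < N.+1) q ^+ k * k%:R) - (1 - q) * N%:R * (1 - q ^+ N.+1) by ring.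
  rewrite geometric_mean_sum; set Q := q ^+ N.+1.
  have E : n * (q - Q - (1 - q) * N%:R * Q) - (1 - q) * N%:R * (1 - Q) =
     n * (1 - Q) - (1 - q) * (n + N%:R * (n * Q + 1 - Q)) by ring.
  rewrite E.
  have QE : n * Q + 1 - Q = A^-1.
    by rewrite /Q qN /A; field; rewrite gt_eqF // -/A.
  have Q1 : 1 - Q = (1 - n * c') / A.
    by rewrite /Q qN /A; field; rewrite gt_eqF // -/A.
  have c1 : 0 < 1 - n * c' by rewrite subr_gt0.
  rewrite QE Q1 subr_ge0.
  have s0 : 0 <= n + N%:R * A^-1.
    by rewrite addr_ge0 ?mulr_ge0 ?ler0n // invr_ge0 ltW.
  apply: le_trans (_ : h * (n + N%:R * A^-1) <= _); first exact: ler_wpM2r.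
  rewrite /h mulrAC ler_pdivrMr ?ltr0n //.
  have H : n <= N%:R * dl by rewrite -ler_pdivrMr.
  have -> : n * ((1 - n * c') / A) * N.+1%:R =
     D * (N%:R * dl + N%:R * A^-1) + n * (1 - n * c') / A.
    by rewrite /dl -natr1; field; rewrite !gt_eqF.
  apply: le_trans (_ : D * (N%:R * dl + N%:R * A^-1) <= _).
    by rewrite ler_pM2l // lerD2r.
  by rewrite lerDl divr_ge0 ?mulr_ge0 ?ler0n // ltW.
have [w [w0 wadm wg]] := decreasing_mix K3 NK gdecr gN gmean.
exists c', q, N, w; split => //.
- by rewrite (ltW cc') ge_min lexx.
- by rewrite q0 ltW.
- rewrite -expRM_natl mulrN.
  rewrite mulrC -ler_pdivrMr // div1r.
  apply: le_trans (expR_ge1Dx _).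
  suff : (2 * K).+1%:R * h <= 1 - rho^-1 by lra.
  rewrite /h mulrA ler_pdivrMr ?ltr0n // [leLHS]mulrC [leRHS]mulrC -ler_pdivrMr //.
  by apply: le_trans Nx2 _; rewrite ler_nat.
- split => //; move=> k kN; rewrite wg // /g kN //.
Qed.

Lemma clip_minE (R : realFieldType) (x l lam : R) : 0 <= lam ->
  lam * clip ((x - l) / lam) = Num.min x (l + lam) - Num.min x l.
Proof.
rewrite le_eqVlt => /orP[/eqP <-|lam0]; first by rewrite mul0r addr0 subrr.
have [xl|lx] := leP x l.
  rewrite clip_le0; last by rewrite pmulr_lle0 ?invr_gt0 // subr_le0.
  by rewrite mulr0 min_l ?subrr //; lra.
have [xl|lx'] := leP x (l + lam).
  rewrite clip_id; first by rewrite mulrC divfK // gt_eqF.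
  apply/andP; split; first by rewrite divr_ge0 ?subr_ge0 // ltW.
  by rewrite ler_pdivrMr // mul1r; lra.
rewrite clip_ge1; last by rewrite ler_pdivlMr // mul1r; lra.
lra.
Qed.

(** Used to permute the coordinates of a tuple so that each coordinate receives
    the same share of the total occupancy. *)
Lemma latin_square K : exists f : 'I_K -> 'I_K -> 'I_K,
  (forall i, bijective (f ^~ i)) /\ (forall s, bijective (f s)).
Proof.
case: K => [|K]; first by exists (fun s _ => s); split => -[].
exists (fun s i => s + i); split => x.
  by exists (fun y => y - x) => y; [exact: addrK|exact: subrK].
by exists (fun y => - x + y) => y; [exact: addKr|exact: addNKr].
Qed.

Section Extremal.
Variables (R : realType) (K : nat) (c rho : R).
Hypothesis K2 : (2 <= K)%N.
Hypothesis good : cK_spec K c.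
Hypothesis rho1 : 1 < rho.
Let n : R := K%:R.
Let n2 : 2 <= n. Proof. by rewrite /n ler_nat. Qed.

(** The left-hand side increases in v up to 1/(n (n - 1)); Bernoulli's inequality
    compares two values without derivatives. *)
Lemma tail_prod_le (c' v : R) : 0 <= v <= c' -> n * (n - 1) * c' <= 1 ->
  v * (1 - (n - 1) * v) ^+ K.-1 <= c' * (1 - (n - 1) * c') ^+ K.-1.
Proof.
move=> /andP[v0 vc] nc.
set m := n - 1; have mE : m = K.-1%:R by rewrite /m /n -subn1 natrB // (leq_trans _ K2).
have m1 : 1 <= m by rewrite /m; move: n2; lra.
have nE : n = m + 1 by rewrite /m; ring.
rewrite nE -/m in nc.
move: v0; rewrite le_eqVlt => /orP[/eqP v0|v0].
  by rewrite -v0 mul0r mulr_ge0 ?exprn_ge0 //; nra.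
have c0 : 0 < c' by lra.
have Bc : 0 < 1 - m * c' by nra.
have Bv : 0 < 1 - m * v by nra.
set x := m * (c' - v) / (1 - m * v).
have x0 : 0 <= x by rewrite divr_ge0 ?mulr_ge0 //; lra.
have E : 1 - m * c' = (1 - m * v) * (1 - x) by rewrite /x; field; rewrite gt_eqF.
have x1 : x < 1 by rewrite ltr_pdivrMr // mul1r; lra.
rewrite E exprMn mulrCA [leLHS]mulrC ler_pM2l ?exprn_gt0 //.
have bern : 1 - m * x <= (1 - x) ^+ K.-1.
  rewrite mE; elim: (K.-1) => [|k IH]; first by rewrite mul0r subr0 expr0.
  rewrite exprS -natr1.
  apply: le_trans (_ : (1 - x) * (1 - k%:R * x) <= _).
    have : 0 <= k%:R * (x * x) by rewrite mulr_ge0 // mulr_ge0.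
    by lra.
  by rewrite ler_pM2l ?subr_gt0.
rewrite -ler_pdivrMl // mulrC; apply: le_trans bern.
have -> : 1 - m * x = 1 - m * m * (c' - v) / (1 - m * v) by rewrite /x; ring.
have -> : v / c' = 1 - (c' - v) / c' by field; rewrite gt_eqF.
rewrite lerD2l lerN2.
have -> : m * m * (c' - v) / (1 - m * v) = (c' - v) * (m * m / (1 - m * v)) by ring.
apply: ler_wpM2l; first by lra.
by rewrite ler_pdivrMr // ler_pdivlMl //; nra.
Qed.

(** Two kinds of pieces: a tuple of cells of the bulk, all increasing in y, with
    coordinates permuted according to s; and, for each s, the piece in which coordinate s
    runs up [0, c'] while the others run down [A, 1]. The distribution functions
    of the cells telescope by [clip_minE]. *)
Lemma extremal_pieces : exists (J : finType) (w : J -> R) (l lam : J -> 'I_K -> R)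
    (rev : J -> 'I_K -> bool),
  [/\ forall j, 0 <= w j,
      forall j i, 0 < w j -> [/\ 0 <= l j i, 0 < lam j i & l j i + lam j i <= 1],
      forall i x, 0 <= x -> \sum_j w j * clip ((x - l j i) / lam j i) = Num.min x 1
    & forall j y, 0 < w j -> 0 <= y <= 1 ->
       \prod_i place (rev j i) (l j i) (lam j i) y <=
         rho ^+ 2 * (c * (1 - (n - 1) * c) ^+ K.-1)].
Proof.
have [c' [q [N [w [/andP[cc' c'r] nc' /andP[q0 q1] qr]]]]] := bulk_coupling_exists K2 good rho1.
rewrite /bulk_coupling -/n => -[AQ w0 wadm wocc].
have [f [fi fs]] := latin_square K.
set m := n - 1 in AQ wocc *; set A := 1 - m * c' in AQ wocc.
have rho0 : 0 < rho by exact: lt_trans rho1.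
have c0 : 0 < c by case: good => /andP[].
have c'0 : 0 < c' by exact: lt_le_trans cc'.
have mE : m = K.-1%:R by rewrite /m /n -subn1 natrB // (leq_trans _ K2).
have m1 : 1 <= m by rewrite /m; move: n2; lra.
have nE : n = m + 1 by rewrite /m; ring.
have nc2 : (m + 1) * m * c' <= 1 by rewrite -nE.
have A0 : 0 < A by rewrite /A; nra.
have A1 : A <= 1 by rewrite /A; nra.
have c'1 : c' <= 1 by nra.
pose B := 1 - m * c.
have AB : A <= B by rewrite /A /B; nra.
have B0 : 0 < B by exact: lt_le_trans AB.
pose J : finType := ('I_K * {ffun 'I_K -> 'I_N.+1} + 'I_K)%type.
pose W (j : J) := match j with inl st => w st.2 | inr _ => c' end.
pose L (j : J) (i : 'I_K) : R := match j with
  | inl st => A * q ^+ (st.2 (f st.1 i)).+1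
  | inr s => if i == s then 0 else A end.
pose M (j : J) (i : 'I_K) : R := match j with
  | inl st => A * q ^+ (st.2 (f st.1 i)) * (1 - q)
  | inr s => if i == s then c' else m * c' end.
pose V (j : J) (i : 'I_K) : bool := match j with
  | inl st => false
  | inr s => i != s end.
have LM k : A * q ^+ k.+1 + A * q ^+ k * (1 - q) = A * q ^+ k by rewrite exprS; ring.
have qk1 k : A * q ^+ k <= 1.
  rewrite -[leRHS]mulr1; apply: ler_pM => //; [exact: ltW|by rewrite exprn_ge0 // ltW|].
  by rewrite exprn_ile1 // ltW.
have qk0 k : 0 < A * q ^+ k by rewrite mulr_gt0 // exprn_gt0.
have ordN (k : 'I_N.+1) : (k <= N)%N by rewrite -ltnS.
exists J, W, L, M, V; split.
- by move=> [st|s] /=; [exact: w0|exact: ltW].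
- move=> [[s t]|s] i /= wj; last first.
    case: eqVneq => _; first by rewrite lexx add0r.
    split; [exact: ltW| |by rewrite /A subrK].
    by rewrite mulr_gt0 // (lt_le_trans ltr01).
  split; [exact: ltW| |by rewrite LM].
  rewrite -(wocc _ (ordN (t (f s i)))).
  rewrite (bigD1 t) //= ltr_pwDl //.
    rewrite mulr_gt0 // ltr0n (bigD1 (f s i)) //= eqxx //.
  by apply: sumr_ge0 => t' _; rewrite mulr_ge0 // w0.
- move=> i x x0; rewrite big_sumType /=.
  have bulkE : \sum_(st : 'I_K * {ffun 'I_K -> 'I_N.+1}) W (inl st) *
      clip ((x - L (inl st) i) / M (inl st) i) = Num.min x A - Num.min x c'.
    pose G k := clip ((x - A * q ^+ k.+1) / (A * q ^+ k * (1 - q))).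
    rewrite -(pair_bigA _ (fun s t => w t * G (t (f s i)))) /= exchange_big /=.
    have E (t : {ffun 'I_K -> 'I_N.+1}) : \sum_s w t * G (t (f s i)) =
        \sum_(k < N.+1) w t * (\sum_(i < K) (t i == k :> nat))%:R * G k.
      have -> : \sum_s w t * G (t (f s i)) = w t * \sum_j G (t j).
        by rewrite -mulr_sumr [in RHS](reindex _ (onW_bij _ (fi i))).
      under [RHS]eq_bigr do rewrite -mulrA.
      rewrite -mulr_sumr; congr (_ * _).
      under [RHS]eq_bigr do rewrite natr_sum mulr_suml.
      rewrite exchange_big /=; apply: eq_bigr => j _.
      rewrite (bigD1 (t j)) //= eqxx mul1r big1 ?addr0 // => k.
      by rewrite eq_sym -val_eqE /= => /negbTE ->; rewrite mul0r.
    rewrite (eq_bigr _ (fun t _ => E t)) exchange_big /=.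
    have E2 (k : 'I_N.+1) : \sum_t w t * (\sum_(i < K) (t i == k :> nat))%:R * G k =
        Num.min x (A * q ^+ k) - Num.min x (A * q ^+ k.+1).
      rewrite -mulr_suml (wocc _ (ordN k)) /G clip_minE ?LM //.
      by rewrite mulr_ge0 ?subr_ge0 // ltW.
    rewrite (eq_bigr _ (fun k _ => E2 k)).
    rewrite -[in RHS]AQ.
    elim: N.+1 => [|k IH]; first by rewrite big_ord0 expr0 mulr1 subrr.
    by rewrite big_ord_recr /= IH addrA subrK.
  rewrite bulkE (bigD1 i) //= eqxx subr0.
  have tailE (s : 'I_K) : s != i ->
     c' * clip ((x - (if i == s then 0 else A)) / (if i == s then c' else m * c')) =
     c' * clip ((x - A) / (m * c')).
    by rewrite eq_sym => /negbTE ->.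
  rewrite (eq_bigr _ tailE) sumr_const.
  have -> : #|[pred s : 'I_K | s != i]| = K.-1 by rewrite cardC1 card_ord.
  have -> : c' * clip (x / c') = Num.min x c'.
    have := @clip_minE _ x 0 c' (ltW c'0); rewrite subr0 add0r => ->.
    by rewrite [Num.min x 0]min_r // subr0.
  rewrite -mulr_natl -mE mulrA clip_minE; last by rewrite mulr_ge0 ?ltW // (lt_le_trans ltr01).
  have -> : A + m * c' = 1 by rewrite /A subrK.
  by rewrite addrCA addrC; lra.
- move=> [[s t]|s] y /= wj /andP[y0 y1].
    have step : \prod_i place false (A * q ^+ (t (f s i)).+1) (A * q ^+ t (f s i) * (1 - q)) y
        <= A ^+ K * q ^+ (\sum_(i < K) t i)%N.
      have -> : (\sum_(i < K) t i = \sum_(i < K) t (f s i))%N.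
        by rewrite (reindex _ (onW_bij _ (fs s))).
      rewrite expr_sum -[X in _ <= A ^+ X * _]card_ord -prodr_const -big_split /=.
      apply: ler_prod => i _; rewrite /place /=.
      have h := LM (t (f s i)).
      have h1 : 0 <= A * q ^+ t (f s i) * (1 - q) by rewrite mulr_ge0 ?subr_ge0 // ltW.
      apply/andP; split; first by apply: addr_ge0; [exact: ltW|exact: mulr_ge0].
      by rewrite -[leRHS]h lerD2l ler_piMr.
    apply: le_trans step _.
    have adm := wadm t wj.
    have AK : A ^+ K = A * A ^+ K.-1 by rewrite -exprS prednK // (leq_trans _ K2).
    have h : A * q ^+ (\sum_(i < K) t i)%N <= rho * c'.
      apply: le_trans (_ : A * q ^+ (\sum_(i < K) t i)%N * (rho * q ^+ (2 * K).+1) <= _).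
        by rewrite ler_peMr // ltW.
      rewrite mulrCA ler_pM2l // -mulrA -exprD -AQ ler_pM2l //.
      by apply: ler_wiXn2l; [exact: ltW|exact: q1|rewrite addnS ltnS].
    apply: le_trans (_ : (rho * c') * A ^+ K.-1 <= _).
      rewrite AK mulrAC ler_pM2r ?exprn_gt0 //.
    rewrite expr2 -mulrA -mulrA ler_pM2l // mulrA.
    apply: ler_pM; [exact: ltW|exact/exprn_ge0/ltW|exact: c'r|].
    by apply: lerXn2r; rewrite ?nnegrE ?(ltW A0) ?(ltW B0).
  have -> : \prod_i place (i != s) (if i == s then 0 else A) (if i == s then c' else m * c') y =
     (c' * y) * (1 - m * (c' * y)) ^+ K.-1.
    rewrite (bigD1 s) //= eqxx /place /= add0r; congr (_ * _).
    rewrite (eq_bigr (fun=> 1 - m * (c' * y))); last first.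
      by move=> i /negbTE -> /=; rewrite /A; ring.
    rewrite prodr_const; congr (_ ^+ _).
    by rewrite cardC1 card_ord.
  have vc : 0 <= c' * y <= c' by rewrite mulr_ge0 ?(ltW c'0) //= ler_piMr // ltW.
  apply: le_trans (tail_prod_le vc nc') _; rewrite -/m -/A -/B.
  have rr : rho <= rho ^+ 2 by rewrite expr2 ler_peMl // ltW.
  rewrite mulrA; apply: ler_pM.
  + exact: ltW.
  + by rewrite exprn_ge0 // ltW.
  + by apply: le_trans c'r _; rewrite ler_pM2r.
  + by apply: lerXn2r; rewrite ?nnegrE ?(ltW A0) ?(ltW B0).
Qed.

End Extremal.

(** * Precision *)

Section Sharpness.
Context (d : measure_display) (T : measurableType d) (R : realType) (P : probability T R).
Hypothesis P_atomless : atomless P.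
Variables (K : nat) (c : R).
Hypothesis K2 : (2 <= K)%N.
Hypothesis good : cK_spec K c.
Let F (q : K.-tuple R) : R := aG K c * geometric_mean q.
Local Notation p := (pr P).

Lemma uniform01_ge0 (U : {RV P >-> R}) t : uniform01 U -> 0 <= U t.
Proof. by move=> [/(_ t)]; rewrite in_itv => /andP[]. Qed.

Lemma event_prod (U : 'I_K -> {RV P >-> R}) (e : R) :
  (forall i, uniform01 (U i)) -> 0 <= e ->
  [set t | F [tuple U i t | i < K] <= e] =
  [set t | \prod_(k < K) U k t <= e ^+ K * (c * (1 - (K%:R - 1) * c) ^+ K.-1)].
Proof.
move=> Uu e0; apply/seteqP.
have E t : (F [tuple U i t | i < K] <= e) =
    (\prod_(k < K) U k t <= e ^+ K * (c * (1 - (K%:R - 1) * c) ^+ K.-1)).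
  rewrite /F aG_mean_le //.
    by congr (_ <= _); apply: eq_bigr => i _; rewrite tnth_mktuple.
  by move=> i; rewrite tnth_mktuple uniform01_ge0.
by split => t /=; rewrite E.
Qed.

(** The extremal pieces scaled to [0, e'], completed by one piece on [e', 1] in
    which all coordinates agree; the loss rho^2 <= rho^K is paid for by the ratio
    rho = e / e'. *)
Lemma sharp_bound (e' e : R) : 0 < e' -> e' < e -> e < 1 ->
  exists U : 'I_K -> {RV P >-> R}, (forall i, uniform01 (U i)) /\
    (e'%:E <= P [set t | (F [tuple U i t | i < K] <= e)%R])%E.
Proof.
move=> e'0 e'e e1.
have e0 : 0 < e := lt_trans e'0 e'e.
have e'1 : e' < 1 := lt_trans e'e e1.
pose rho := e / e'.
have rho1 : 1 < rho by rewrite ltr_pdivlMr // mul1r.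
have [J [w [l [lam [rev [w0 cell cover prodb]]]]]] := extremal_pieces K2 good rho1.
pose w' (j : option J) := if j is Some j then e' * w j else 1 - e'.
pose l' (j : option J) (i : 'I_K) := if j is Some j then e' * l j i else e'.
pose lam' (j : option J) (i : 'I_K) := if j is Some j then e' * lam j i else 1 - e'.
pose rev' (j : option J) (i : 'I_K) := if j is Some j then rev j i else false.
have w'0 j : 0 <= w' j.
  by case: j => [j|] /=; [rewrite mulr_ge0 // ltW|rewrite subr_ge0 ltW].
have cell' j i : 0 < w' j -> [/\ 0 <= l' j i, 0 < lam' j i & l' j i + lam' j i <= 1].
  case: j => [j|] /=.
    rewrite pmulr_rgt0 // => /(cell j i)[h1 h2 h3]; split.
    - by rewrite mulr_ge0 // ltW.
    - exact: mulr_gt0.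
    - by rewrite -mulrDr; apply: mulr_ile1 => //; [exact: ltW|lra|exact: ltW].
  by move=> h; split; [exact: ltW|exact: h|lra].
have cover' i x : 0 <= x <= 1 -> \sum_j w' j * clip ((x - l' j i) / lam' j i) = x.
  move=> /andP[x0 x1]; rewrite (bigD1 None) //= clip_minE; last by rewrite subr_ge0 ltW.
  have -> : \sum_(j | j != None) w' j * clip ((x - l' j i) / lam' j i) =
     e' * \sum_j w j * clip ((x / e' - l j i) / lam j i).
    rewrite mulr_sumr (reindex_omap Some id) /=; last by case.
    rewrite (eq_bigl xpredT); last by move=> j; rewrite eqxx.
    apply: eq_bigr => j _; rewrite -mulrA; congr (_ * (_ * clip _)).
    have [->|lj] := eqVneq (lam j i) 0; first by rewrite mulr0 invr0 !mulr0.
    by field; rewrite lj gt_eqF.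
  rewrite cover; last by rewrite divr_ge0 // ltW.
  rewrite minr_pMr ?(ltW e'0) // mulr1 mulrCA divff ?gt_eqF // mulr1.
  rewrite (_ : e' + (1 - e') = 1); last by ring.
  by rewrite subrK min_l.
have w'1 : \sum_j w' j = 1.
  have K0 : (0 < K)%N by exact: ltnW.
  rewrite -[RHS](cover' (Ordinal K0) 1); last by rewrite ler01 lexx.
  apply: eq_bigr => j _; have [wj|wj] := ltP 0 (w' j).
    have [h1 h2 h3] := cell' j (Ordinal K0) wj.
    by rewrite clip_ge1 ?mulr1 // ler_pdivlMr // mul1r; lra.
  by have -> : w' j = 0; [apply/eqP; rewrite eq_le wj w'0|rewrite mul0r].
have [U [Uu [B [mB pB HB]]]] := piecewise_uniform P_atomless rev' None w'0 w'1 cell' cover'.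
exists U; split => //.
rewrite event_prod //; last exact: ltW.
have -> : e' = p B by rewrite pB /=; ring.
rewrite -prE; last exact: mB.
apply: le_measure; rewrite ?inE; [exact: mB|exact: measurable_prod_le|].
have A0 := cK_A_gt0 K2 good.
have c0 : 0 < c by case: good => /andP[].
move=> t /HB[H|[[j|] [y [jo wj y01 H]]]] //=.
  have K0 : (0 < K)%N by exact: ltnW.
  rewrite (bigD1 (Ordinal K0)) //= H mul0r mulr_ge0 ?exprn_ge0 ?(ltW e0) //.
  by rewrite mulr_ge0 ?exprn_ge0 // ltW.
have -> : \prod_(k < K) U k t = e' ^+ K * \prod_(k < K) place (rev j k) (l j k) (lam j k) y.
  rewrite -[X in _ ^+ X]card_ord -prodr_const -big_split /=; apply: eq_bigr => k _.
  by rewrite H /place /=; ring.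
have wj' : 0 < w j by move: wj; rewrite /= pmulr_rgt0.
apply: le_trans (_ : e' ^+ K * (rho ^+ 2 * (c * (1 - (K%:R - 1) * c) ^+ K.-1)) <= _).
  by rewrite ler_pM2l ?exprn_gt0 //; exact: prodb.
rewrite mulrA ler_pM2r; last by rewrite mulr_gt0 // exprn_gt0.
have -> : e = e' * rho by rewrite /rho mulrCA divff ?mulr1 // gt_eqF.
rewrite [leRHS]exprMn ler_pM2l ?exprn_gt0 //.
by rewrite ler_weXn2l // ltW.
Qed.

Lemma precise_aG : precise_merging_function P F.
Proof.
have a0 : 0 < aG K c by exact: aG_gt0 good.
have valid e : 0 < e < 1 -> (sup_prob_le P F e <= e%:E)%E.
  move=> e01; apply: ge_ereal_sup => _ [U /= Uu <-].
  have e0 : 0 <= e by case/andP: e01 => /ltW.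
  by rewrite event_prod // prE ?lee_fin; [exact: prod_small_bound|exact: measurable_prod_le].
split; last first.
  move=> e /andP[e0 e1]; apply/eqP; rewrite eq_le valid ?e0 //=.
  apply/lee_subgt0Pr => x x0.
  pose e' := Num.max (e - x) (e / 2).
  have [||U [Uu HU]] := @sharp_bound e' e _ _ e1.
  - by rewrite lt_max divr_gt0 // orbT.
  - by rewrite gt_max; apply/andP; split; lra.
  apply: (@le_trans _ _ e'%:E); first by rewrite lee_fin le_max lexx.
  apply: le_trans HU _; apply: ereal_sup_ubound.
  by exists U.
split => //.
- apply: measurable_funTS; apply: measurable_funM; first exact: measurable_cst.
  rewrite /geometric_mean.
  apply: (@measurableT_comp _ _ _ _ _ _ (fun x : R => x `^ K%:R^-1)).
    exact: measurable_powR.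
  by apply: measurable_prod => k _; exact: measurable_tnth.
- by move=> q _; rewrite mulr_ge0 ?powR_ge0 // ltW.
- move=> i q q' cq cq' H Hi; rewrite /F ler_pM2l // /geometric_mean.
  have q0 (r : K.-tuple R) : cube r -> forall j, 0 <= tnth r j.
    by move=> cr j; have := cr j; rewrite in_itv => /andP[].
  apply: ge0_ler_powR; rewrite ?nnegrE ?invr_ge0 ?ler0n //.
  + by apply: prodr_ge0 => j _; exact: q0.
  + by apply: prodr_ge0 => j _; exact: q0.
  + apply: ler_prod => j _; rewrite q0 //=.
    by have [->|ji] := eqVneq j i; [|rewrite H].
Qed.

End Sharpness.

Theorem proposition6 (R : realType) (d : measure_display)
    (T : measurableType d) (P : probability T R) (P_atomless : atomless P) :
  exists c : nat -> R,
    [/\ (forall K : nat, (2 < K)%N ->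
          unique (fun x : R => 0 < x < K%:R^-1 /\ cK_equation K x) (c K)),
        c 2%N = 2^-1 /\
          unique (fun x : R => 0 < x <= 2^-1 /\ cK_equation 2 x) (c 2%N),
        (forall K : nat, (2 <= K)%N ->
          precise_merging_function P
            (fun p : K.-tuple R => aG K (c K) * geometric_mean p)),
        (forall K : nat, (2 <= K)%N -> aG K (c K) <= expR 1)
      & aG K (c K) @[K --> \oo] --> expR 1].
Proof.
have /choice[c good] K : exists x : R, (2 <= K)%N -> cK_spec K x.
  by have [K2|_] := leqP 2 K; [have [x] := cK_exists R K2; exists x|exists 0].
exists c; split.
- by move=> K K3; have [+ _] := cK_uniq (ltnW K3) (good K (ltnW K3)); apply.
- split; first by have [_ _ _] := good 2%N isT; apply.
  by have [_] := cK_uniq (leqnn 2) (good 2%N isT); apply.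
- by move=> K K2; apply: precise_aG => //; exact: good.
- by move=> K K2; apply: aG_le_e => //; exact: good.
- exact: aG_cvg.
Qed.
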